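(* Let $R$ be a 2-dimensional excellent regular local ring with quotient field $K$. Let $\nu$ be a valuation of $K$ which dominates $R$. Suppose that $\nu$ has rational rank 1 and $\nu$ is not discrete. Suppose that $R\rightarrow R'$ is a nontrivial sequence of quadratic transforms along $\nu$. Then ${\rm gr}_{\nu}(R')$ is not a finitely generated ${\rm gr}_{\nu}(R)$-algebra.
   Context: For a valuation $\nu$ of a field $K$, $\Phi_\nu$ denotes its value group, $V_\nu$ its valuation ring and $m_\nu$ the maximal ideal of $V_\nu$. The rational rank of $\nu$ is $\dim_{\mathbb Q}(\Phi_\nu\otimes_{\mathbb Z}\mathbb Q)$; a rational rank 1 valuation is discrete if $\Phi_\nu\cong\mathbb Z$. A valuation $\nu$ dominates a local domain $R$ if $R\subset V_\nu$ and $m_\nu\cap R=m_R$. If $\nu$ dominates the local domain $R$, the associated graded ring of $R$ along $\nu$ is ${\rm gr}_\nu(R)=\bigoplus_{\gamma\in\Phi_\nu}\mathcal P_\gamma(R)/\mathcal P^+_\gamma(R)$, where $\mathcal P_\gamma(R)=\{f\in R\mid \nu(f)\ge\gamma\}$ and $\mathcal P^+_\gamma(R)=\{f\in R\mid\nu(f)>\gamma\}$. If $R\subset R'$ are both dominated by $\nu$, there is a natural graded inclusion ${\rm gr}_\nu(R)\to{\rm gr}_\nu(R')$, which makes ${\rm gr}_\nu(R')$ a ${\rm gr}_\nu(R)$-algebra. If $R$ is a 2-dimensional regular local ring dominated by $\nu$, with regular parameters $u,v$, the quadratic transform of $R$ along $\nu$ is the 2-dimensional regular local ring $T_1=R[\frac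 vu]_{R[\frac vu]\cap m_\nu}$ if $\nu(u)\le\nu(v)$, and $T_1=R[\frac uv]_{R[\frac uv]\cap m_\nu}$ if $\nu(u)>\nu(v)$; it is dominated by $\nu$. A nontrivial sequence of quadratic transforms along $\nu$ is a finite composition $R\to T_1\to\cdots\to T_n=R'$ with $n\ge 1$, each ring being the quadratic transform of the preceding one along $\nu$. *)

(* Defs.v *)
From HB Require Import structures.
From mathcomp Require Import all_boot all_order all_algebra all_field.
From mathcomp Require Import finmap.
From mathcomp Require Import boolp classical_sets.
From mathcomp Require Import monalg.

Set Implicit Arguments.
Unset Strict Implicit.
Unset Printing Implicit Defensive.

Import Order.TTheory GRing.Theory Num.Theory.
Local Open Scope classical_set_scope.
Local Open Scope ring_scope.

Section Ideals.
Variable A : comPzRingType.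
Implicit Types (I J m p : set A).

Definition ideal I : Prop :=
  [/\ I 0, (forall x y, I x -> I y -> I (x + y)) &
      forall a x, I x -> I (a * x)].

Definition prime_ideal p : Prop :=
  [/\ ideal p, ~ p 1 & forall x y, p (x * y) -> p x \/ p y].

Definition maximal_ideal m : Prop :=
  [/\ ideal m, ~ m 1 &
      forall I, ideal I -> m `<=` I -> I = m \/ I = setT].

Definition ideal_gen (S : set A) : set A := smallest ideal S.

Definition ideal_mul I J : set A :=
  ideal_gen [set z | exists x y, [/\ I x, J y & z = x * y]].

Definition ideal_exp I (n : nat) : set A := iter n (ideal_mul I) setT.

Definition noetherian : Prop :=
  forall I, ideal I -> exists s : seq A, I = ideal_gen [set` s].

(** [A] is a local ring and [m] is its maximal ideal. *)
Definition local_ring_with m : Prop :=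
  maximal_ideal m /\ forall m', maximal_ideal m' -> m' = m.

Definition prime_chain (c : nat -> set A) (n : nat) : Prop :=
  (forall i, (i <= n)%N -> prime_ideal (c i)) /\
  (forall i, (i < n)%N -> c i `<` c i.+1).

Definition krull_dim (d : nat) : Prop :=
  (exists c, prime_chain c d) /\
  (forall c n, prime_chain c n -> (n <= d)%N).

Definition regular_local_ring_dim (d : nat) : Prop :=
  [/\ noetherian, krull_dim d &
      exists2 s : seq A, size s = d & local_ring_with (ideal_gen [set` s])].

Definition regular_local_ring : Prop := exists d, regular_local_ring_dim d.

Definition saturated_chain (p q : set A) (c : nat -> set A) (n : nat) : Prop :=
  [/\ c 0 = p, c n = q, prime_chain c n &
      forall i r, (i < n)%N -> prime_ideal r -> ~ (c i `<` r /\ r `<` c i.+1)].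

Definition catenary : Prop :=
  forall p q, prime_ideal p -> prime_ideal q -> p `<=` q ->
  exists2 n, (exists c, saturated_chain p q c n) &
             forall c k, saturated_chain p q c k -> k = n.

End Ideals.

Section AlgebraMaps.

Definition finitely_generated_algebra (A B : comPzRingType)
    (f : {rmorphism A -> B}) : Prop :=
  exists s : seq B, forall P : set B,
    (forall a, P (f a)) -> (forall x, x \in s -> P x) ->
    (forall x y, P x -> P y -> P (x + y)) ->
    (forall x y, P x -> P y -> P (x * y)) ->
    forall b, P b.

(** [f : A -> B] is a localization of [A] at the prime ideal [p]. *)
Definition localization_at (A : comPzRingType) (p : set A)
    (B : comPzRingType) (f : {rmorphism A -> B}) : Prop :=
  [/\ forall s, ~ p s -> exists t, f s * t = 1,
      forall b, exists a s, ~ p s /\ b * f s = f a &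
      forall a, f a = 0 -> exists2 s, ~ p s & s * a = 0].

(** [h : A -> k] is the residue field of the prime ideal [q], that is, the
    fraction field of [A / q]. *)
Definition residue_field_at (A : comPzRingType) (q : set A)
    (k : fieldType) (h : {rmorphism A -> k}) : Prop :=
  (forall a, h a = 0 <-> q a) /\
  (forall x, exists a b, h b != 0 /\ x = h a / h b).

(** [D], with [i] and [j], is the tensor product of the [A]-algebras [B] and
    [C], that is, their coproduct among commutative [A]-algebras. *)
Definition is_tensor_product (A B C D : comPzRingType)
    (f : {rmorphism A -> B}) (g : {rmorphism A -> C})
    (i : {rmorphism B -> D}) (j : {rmorphism C -> D}) : Prop :=
  (forall a, i (f a) = j (g a)) /\
  forall (E : comPzRingType) (h : {rmorphism B -> E}) (k : {rmorphism C -> E}),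
    (forall a, h (f a) = k (g a)) ->
    (exists l : {rmorphism D -> E},
       (forall b, l (i b) = h b) /\ (forall c, l (j c) = k c)) /\
    (forall l l' : {rmorphism D -> E},
       (forall b, l (i b) = l' (i b)) -> (forall c, l (j c) = l' (j c)) ->
       forall d, l d = l' d).

(** [f : A -> Ah] is the completion [lim A / m ^ n]; [J n] is the kernel of the
    projection [Ah -> A / m ^ n]. The last two conditions say that the map from
    [Ah] to the inverse limit is injective and surjective. *)
Definition adic_completion (A : comPzRingType) (m : set A)
    (Ah : comPzRingType) (f : {rmorphism A -> Ah}) : Prop :=
  exists J : nat -> set Ah,
    [/\ forall n, ideal (J n) /\ J n.+1 `<=` J n,
        forall n a, J n (f a) <-> ideal_exp m n a,
        forall n b, exists a, J n (b - f a),
        forall b, (forall n, J n b) -> b = 0 &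
        forall a : nat -> A, (forall n, ideal_exp m n (a n.+1 - a n)) ->
          exists b, forall n, J n (b - f (a n))].

Definition regular_at (A : comPzRingType) (p : set A) : Prop :=
  exists (B : comPzRingType) (f : {rmorphism A -> B}),
    localization_at p f /\ regular_local_ring B.

Definition regular_ring (A : comPzRingType) : Prop :=
  noetherian A /\ forall p : set A, prime_ideal p -> regular_at p.

(** The [k]-algebra [F] is geometrically regular: [F (x)_k L] is regular for
    every finite field extension [L] of [k]. *)
Definition geometrically_regular (k : fieldType) (F : comPzRingType)
    (h : {rmorphism k -> F}) : Prop :=
  forall (L : fieldExtType k) (D : comPzRingType)
         (i : {rmorphism F -> D}) (j : {rmorphism L -> D}),
    is_tensor_product h (in_alg L) i j -> regular_ring D.

Definition geometrically_regular_formal_fibres (A : comPzRingType) : Prop :=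
  forall (m : set A) (Ah : comPzRingType) (c : {rmorphism A -> Ah}),
    local_ring_with m -> adic_completion m c ->
  forall (q : set A) (k : fieldType) (h : {rmorphism A -> k}),
    prime_ideal q -> residue_field_at q h ->
  forall (F : comPzRingType) (i : {rmorphism Ah -> F}) (j : {rmorphism k -> F}),
    is_tensor_product c h i j -> geometrically_regular j.

(** The flatness of [A_p] to its completion, which is part of some definitions
    of a G-ring, is automatic for a noetherian ring. *)
Definition G_ring (A : comPzRingType) : Prop :=
  noetherian A /\
  forall (p : set A) (Ap : comPzRingType) (f : {rmorphism A -> Ap}),
    prime_ideal p -> localization_at p f ->
    geometrically_regular_formal_fibres Ap.

(** The regular locus of [Spec B] is the complement of the closed set defined
    by [I]. *)
Definition J2_ring (A : comPzRingType) : Prop :=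
  forall (B : comPzRingType) (f : {rmorphism A -> B}),
    finitely_generated_algebra f ->
  exists2 I : set B, ideal I &
    forall p : set B, prime_ideal p -> (regular_at p <-> ~ (I `<=` p)).

Definition universally_catenary (A : comPzRingType) : Prop :=
  noetherian A /\
  forall (B : comPzRingType) (f : {rmorphism A -> B}),
    finitely_generated_algebra f -> catenary B.

Definition excellent (A : comPzRingType) : Prop :=
  [/\ noetherian A, universally_catenary A, G_ring A & J2_ring A].

End AlgebraMaps.

Section Subrings.
Variable K : fieldType.

Record subring_type (R : subringClosed K) : predArgType := SubringType {
  subring_val : K;
  _ : subring_val \in R
}.

HB.instance Definition _ (R : subringClosed K) :=
  [isSub for @subring_val R].
HB.instance Definition _ (R : subringClosed K) :=
  [Choice of subring_type R by <:].
HB.instance Definition _ (R : subringClosed K) :=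
  [SubChoice_isSubComNzRing of subring_type R by <:].

Definition has_fraction_field (R : subringClosed K) : Prop :=
  forall x : K, exists a b : K, [/\ a \in R, b \in R, b != 0 & x = a / b].

Definition adjoin (R : subringClosed K) (x : K) : set K :=
  [set z | exists2 p : {poly K}, p \is a polyOver R & z = p.[x]].

End Subrings.

HB.mixin Record isOrderedZmodule V of Num.POrderedZmodule V := {
  oz_le_total : total (<=%R : rel V);
  oz_lerD2l : forall x y z : V, y <= z -> x + y <= x + z
}.

#[short(type="orderedZmodType")]
HB.structure Definition OrderedZmodule :=
  { V of Num.POrderedZmodule V & isOrderedZmodule V }.

(** [Phi] is the value group itself, by surjectivity. The value of [vfun] at [0]
    is irrelevant: [0] has value infinity, as [val_ge] and [val_gt] reflect. *)
Record valuation (K : fieldType) (Phi : orderedZmodType) := Valuation {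
  vfun :> K -> Phi;
  vfunM : forall x y, x != 0 -> y != 0 -> vfun (x * y) = vfun x + vfun y;
  vfunD : forall x y, x != 0 -> y != 0 -> x + y != 0 ->
    Order.min (vfun x) (vfun y) <= vfun (x + y);
  vfun_surj : forall g, exists2 x, x != 0 & vfun x = g
}.

Section ValuationDefs.
Variables (K : fieldType) (Phi : orderedZmodType) (nu : valuation K Phi).

Definition val_ge (g : Phi) : pred K := [pred x | (x == 0) || (g <= nu x)].
Definition val_gt (g : Phi) : pred K := [pred x | (x == 0) || (g < nu x)].

Definition val_ring : set K := [set x | val_ge 0 x].
Definition val_max_ideal : set K := [set x | val_gt 0 x].

Definition dominates (R : subringClosed K) : Prop :=
  (forall x, x \in R -> val_ring x) /\
  local_ring_with [set x : subring_type R | val_max_ideal (val x)].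

(** [u, v] generate the maximal ideal of the local ring [R]. *)
Definition regular_parameters (R : subringClosed K) (u v : subring_type R) :
  Prop := local_ring_with (ideal_gen [set u; v]).

(** [T] is the localization of [R[x]] at its intersection with the maximal ideal
    of the valuation ring. *)
Definition quadratic_transform (R T : subringClosed K) : Prop :=
  exists u v : subring_type R, regular_parameters u v /\
  let x := if nu (val u) <= nu (val v) then val v / val u else val u / val v in
  forall z, z \in T <->
    exists a b, [/\ adjoin R x a, adjoin R x b, ~ val_max_ideal b & z = a / b].

Inductive quadratic_transforms (R T : subringClosed K) : Prop :=
| QTstep of quadratic_transform R T
| QTcons (S : subringClosed K) of
    quadratic_transform R S & quadratic_transforms S T.

Lemma quadratic_transform_sub (R T : subringClosed K) :
  quadratic_transform R T -> {subset R <= T}.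
Proof.
move=> [u [v [_ H]]] y yR; apply/(H y); exists y, 1; split.
- by exists y%:P; rewrite ?polyOverC ?hornerC.
- by exists 1%:P; rewrite ?polyOverC ?hornerC ?rpred1.
- rewrite /val_max_ideal /val_gt /= oner_eq0 /=.
  have := vfunM nu (oner_neq0 K) (oner_neq0 K).
  by rewrite mulr1 -[X in X = _]addr0 => /addrI <-; rewrite ltxx.
- by rewrite divr1.
Qed.

Lemma quadratic_transforms_sub (R T : subringClosed K) :
  quadratic_transforms R T -> {subset R <= T}.
Proof.
elim=> {R T} [R T /quadratic_transform_sub //|].
by move=> R T S /quadratic_transform_sub RS _ ST x /RS /ST.
Qed.

End ValuationDefs.

(** [i : Phi -> V] is the universal additive map to a rational vector space,
    so [V] is the extension of scalars of [Phi] from the integers to [rat]. *)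
Definition is_rationalization (Phi : zmodType) (V : lmodType rat)
    (i : {additive Phi -> V}) : Prop :=
  forall (W : lmodType rat) (f : {additive Phi -> W}),
    (exists g : {linear V -> W}, forall x, g (i x) = f x) /\
    (forall g g' : {linear V -> W},
       (forall x, g (i x) = g' (i x)) -> forall v, g v = g' v).

Definition rational_rank (Phi : zmodType) (r : nat) : Prop :=
  exists (V : vectType rat) (i : {additive Phi -> V}),
    is_rationalization i /\ \dim {:V} = r.

Definition discrete_value_group (Phi : zmodType) : Prop :=
  exists f : {additive Phi -> int}, bijective f.

(** The group algebra [K[t^Phi]]. The product of [monalg] is only available for
    monoids without nontrivial units, so it is redefined here. *)

Section GroupAlgebra.
Local Open Scope fset_scope.
Variables (K : fieldType) (Phi : zmodType).

Definition group_algebra : Type := {malg K[Phi]}.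
HB.instance Definition _ := GRing.Zmodule.on group_algebra.

Implicit Types (f g h : {malg K[Phi]}) (a b : Phi).

Definition ga_one : {malg K[Phi]} := << 1 *g 0 >>.
Definition ga_mul f g : {malg K[Phi]} :=
  \sum_(a <- msupp f) \sum_(b <- msupp g) << f@_a * g@_b *g (a + b)%R >>.

Lemma ga_mulw (d1 d2 : {fset Phi}) f g :
  msupp f `<=` d1 -> msupp g `<=` d2 ->
  ga_mul f g = \sum_(a <- d1) \sum_(b <- d2) << f@_a * g@_b *g (a + b)%R >>.
Proof.
move=> le1 le2; rewrite /ga_mul (big_fset_incl _ le1) /=.
  apply/eq_bigr=> a _; apply/big_fset_incl => // b _ /mcoeff_outdom ->.
  by rewrite mulr0 monalgU0.
move=> a _ /mcoeff_outdom fa.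
by rewrite big1 // => b _; rewrite fa mul0r monalgU0.
Qed.

Lemma ga_mulC : commutative ga_mul.
Proof.
move=> f g; rewrite /ga_mul exchange_big; apply: eq_bigr => a _.
by apply: eq_bigr => b _; rewrite mulrC addrC.
Qed.

Lemma ga_mulDl : left_distributive ga_mul +%R.
Proof.
move=> f1 f2 g.
rewrite [in RHS](ga_mulw (fsubsetUl _ (msupp f2)) (fsubset_refl _)).
rewrite [in RHS](ga_mulw (fsubsetUr (msupp f1) _) (fsubset_refl _)).
rewrite (ga_mulw (msuppD_le _ _) (fsubset_refl _)).
rewrite -big_split /=; apply/eq_bigr=> a _.
rewrite -big_split /=; apply/eq_bigr=> b _.
by rewrite mcoeffD mulrDl monalgUD.
Qed.

Lemma ga_mul0l : left_zero 0 ga_mul.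
Proof. by move=> g; rewrite /ga_mul msupp0 big_seq_fset0. Qed.

Lemma ga_mulDr : right_distributive ga_mul +%R.
Proof. by move=> f g h; rewrite ![ga_mul f _]ga_mulC ga_mulDl. Qed.

Lemma ga_mul0r : right_zero 0 ga_mul.
Proof. by move=> f; rewrite ga_mulC ga_mul0l. Qed.

Lemma ga_mulUU (x y : K) a b :
  ga_mul << x *g a >> << y *g b >> = << x * y *g (a + b)%R >>.
Proof. by rewrite (ga_mulw msuppU_le msuppU_le) !big_seq_fset1 !mcoeffUU. Qed.

Lemma ga_mul_suml (I : Type) (r : seq I) (F : I -> {malg K[Phi]}) g :
  ga_mul (\sum_(i <- r) F i) g = \sum_(i <- r) ga_mul (F i) g.
Proof. exact: (big_morph (ga_mul^~ g) (fun _ _ => ga_mulDl _ _ _) (ga_mul0l _)). Qed.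

Lemma ga_mul_sumr (I : Type) (r : seq I) (F : I -> {malg K[Phi]}) g :
  ga_mul g (\sum_(i <- r) F i) = \sum_(i <- r) ga_mul g (F i).
Proof. exact: (big_morph (ga_mul g) (fun _ _ => ga_mulDr _ _ _) (ga_mul0r _)). Qed.

Lemma ga_mulA : associative ga_mul.
Proof.
move=> f g h; rewrite (monalgE f) !ga_mul_suml; apply: eq_bigr => a _.
rewrite (monalgE g) !(ga_mul_suml, ga_mul_sumr); apply: eq_bigr => b _.
rewrite (monalgE h) !ga_mul_sumr; apply: eq_bigr => c _.
by rewrite !ga_mulUU mulrA addrA.
Qed.

Lemma ga_mul1l : left_id ga_one ga_mul.
Proof.
move=> g; rewrite [in LHS](monalgE g) ga_mul_sumr [RHS]monalgE.
by apply: eq_bigr => a _; rewrite ga_mulUU mul1r add0r.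
Qed.

Lemma ga_one_neq0 : ga_one != 0.
Proof. by rewrite monalgU_eq0 oner_eq0. Qed.

HB.instance Definition _ := GRing.Zmodule_isComNzRing.Build group_algebra
  ga_mulA ga_mulC ga_mul1l ga_mulDl ga_one_neq0.

End GroupAlgebra.

Section Coefficients.
Variables (K : fieldType) (Phi : zmodType).

Lemma mcoeff_gaM (f g : group_algebra K Phi) c :
  (f * g)@_c =
  \sum_(a <- msupp f) \sum_(b <- msupp g) f@_a * g@_b *+ (a + b == c).
Proof.
rewrite [f * g]/(ga_mul f g) /ga_mul raddf_sum; apply: eq_bigr => a _.
by rewrite raddf_sum; apply: eq_bigr => b _; rewrite /= mcoeffU.
Qed.

Lemma mcoeff_ga1 c : (1 : group_algebra K Phi)@_c = 1 *+ (0 == c).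
Proof. exact: mcoeffU. Qed.

End Coefficients.

Section ValuationLemmas.
Variables (K : fieldType) (Phi : orderedZmodType) (nu : valuation K Phi).
Implicit Types (x y : K) (a b : Phi).

Lemma oz_ltD2l a b c : b < c -> a + b < a + c.
Proof.
rewrite !lt_neqAle => /andP[ne le]; rewrite oz_lerD2l // andbT.
by apply: contra ne => /eqP/addrI->.
Qed.

Lemma val1 : nu 1 = 0.
Proof.
have := vfunM nu (oner_neq0 K) (oner_neq0 K).
by rewrite mulr1 -[X in X = _]addr0 => /addrI <-.
Qed.

Lemma valN1 : nu (-1) = 0.
Proof.
have n0 : -1 != 0 :> K by rewrite oppr_eq0 oner_neq0.
have := vfunM nu n0 n0; rewrite mulrNN mulr1 val1 => e.
apply/eqP; rewrite eq_le; case/orP: (oz_le_total (nu (-1)) 0) => h.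
  by rewrite h /= {1}e -[leRHS]addr0 oz_lerD2l.
by rewrite h andbT {1}e -[leLHS]addr0 oz_lerD2l.
Qed.

Lemma val_geN a x : val_ge nu a x -> val_ge nu a (- x).
Proof.
rewrite /val_ge /= oppr_eq0; have [//|x0 /=] := eqVneq x 0.
by rewrite -mulN1r vfunM ?oppr_eq0 ?oner_neq0 // valN1 add0r.
Qed.

Lemma val_gt_ge a x : val_gt nu a x -> val_ge nu a x.
Proof. by case/orP=> [/eqP->|/ltW h]; apply/orP; [left|right]. Qed.

Lemma val_ge0 a : val_ge nu a 0. Proof. by rewrite /val_ge /= eqxx. Qed.
Lemma val_gt0 a : val_gt nu a 0. Proof. by rewrite /val_gt /= eqxx. Qed.

Lemma val_geD a x y : val_ge nu a x -> val_ge nu a y -> val_ge nu a (x + y).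
Proof.
rewrite /val_ge /=.
have [->|x0] := eqVneq x 0; first by rewrite add0r.
have [->|y0] := eqVneq y 0; first by rewrite addr0 (negPf x0).
have [//|s0] := eqVneq (x + y) 0.
move=> /= ax ay; apply: le_trans (vfunD nu x0 y0 s0).
by rewrite /Order.min; case: ifP.
Qed.

Lemma val_gtD a x y : val_gt nu a x -> val_gt nu a y -> val_gt nu a (x + y).
Proof.
rewrite /val_gt /=.
have [->|x0] := eqVneq x 0; first by rewrite add0r.
have [->|y0] := eqVneq y 0; first by rewrite addr0 (negPf x0).
have [//|s0] := eqVneq (x + y) 0.
move=> /= ax ay; apply: lt_le_trans (vfunD nu x0 y0 s0).
by rewrite /Order.min; case: ifP.
Qed.

Lemma val_geM a b x y :
  val_ge nu a x -> val_ge nu b y -> val_ge nu (a + b) (x * y).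
Proof.
rewrite /val_ge /= mulf_eq0.
have [->|x0] := eqVneq x 0; first by [].
have [->|y0] := eqVneq y 0; first by [].
move=> /= ax ay; rewrite vfunM //.
apply: (@le_trans _ _ (a + nu y)); first exact: oz_lerD2l.
by rewrite ![_ + nu y]addrC oz_lerD2l.
Qed.

Lemma val_gtM a b x y :
  val_ge nu a x -> val_gt nu b y -> val_gt nu (a + b) (x * y).
Proof.
rewrite /val_ge /val_gt /= mulf_eq0.
have [->|x0] := eqVneq x 0; first by [].
have [->|y0] := eqVneq y 0; first by [].
move=> /= ax ay; rewrite vfunM //.
apply: (@lt_le_trans _ _ (a + nu y)); first exact: oz_ltD2l.
by rewrite ![_ + nu y]addrC oz_lerD2l.
Qed.

End ValuationLemmas.

Section Gr.
Variables (K : fieldType) (Phi : orderedZmodType) (nu : valuation K Phi).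
Variable R : subringClosed K.

(** [P_a(R)] and [P_a^+(R)]. *)
Definition filt (a : Phi) : pred K := [pred x | (x \in R) && val_ge nu a x].
Definition filt_plus (a : Phi) : pred K :=
  [pred x | (x \in R) && val_gt nu a x].

(** The graded subring [\bigoplus_a P_a(R) t^a] of [K[t^Phi]]. *)
Definition rees_pred : pred (group_algebra K Phi) :=
  fun f => all (fun a => filt a f@_a) (msupp f).

Lemma filt0 a : filt a 0.
Proof. by rewrite /filt /= rpred0 val_ge0. Qed.

Lemma filtD a x y : filt a x -> filt a y -> filt a (x + y).
Proof.
by move=> /andP[xR ax] /andP[yR ay]; rewrite /filt /= rpredD // val_geD.
Qed.

Lemma filtM a b x y : filt a x -> filt b y -> filt (a + b) (x * y).
Proof.
by move=> /andP[xR ax] /andP[yR ay]; rewrite /filt /= rpredM // val_geM.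
Qed.

Lemma rees_predP (f : group_algebra K Phi) :
  reflect (forall a, filt a f@_a) (f \in rees_pred).
Proof.
apply: (iffP allP) => [h a|h a _]; last exact: h.
by have [/h|_] := msuppP f a; rewrite ?filt0.
Qed.

Lemma rees_subring_closed : subring_closed rees_pred.
Proof.
split.
- apply/rees_predP => a; rewrite mcoeff_ga1.
  have [<-|_] := eqVneq 0 a; last exact: filt0.
  by rewrite /filt /val_ge /= rpred1 val1 lexx orbT.
- move=> f g /rees_predP hf /rees_predP hg; apply/rees_predP => a.
  rewrite mcoeffB; apply: filtD => //.
  by have /andP[gR ag] := hg a; rewrite /filt /= rpredN gR val_geN.
- move=> f g /rees_predP hf /rees_predP hg; apply/rees_predP => c.
  rewrite mcoeff_gaM.
  apply: (big_ind (filt c)) => [||a _]; [exact: filt0|exact: filtD|].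
  apply: (big_ind (filt c)) => [||b _]; [exact: filt0|exact: filtD|].
  by have [<-|_] := eqVneq (a + b) c; [exact: filtM|exact: filt0].
Qed.

HB.instance Definition _ :=
  GRing.isSubringClosed.Build (group_algebra K Phi) rees_pred
    rees_subring_closed.

Record rees : predArgType := Rees {
  rees_val : group_algebra K Phi;
  _ : rees_val \in rees_pred
}.

HB.instance Definition _ := [isSub for rees_val].
HB.instance Definition _ := [Choice of rees by <:].
HB.instance Definition _ := [SubChoice_isSubComNzRing of rees by <:].

(** The graded ideal [\bigoplus_a P_a^+(R) t^a]. *)
Definition rees_plus : pred rees :=
  fun f => all (fun a => filt_plus a (val f)@_a) (msupp (val f)).

Lemma filt_plus0 a : filt_plus a 0.
Proof. by rewrite /filt_plus /= rpred0 val_gt0. Qed.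

Lemma filt_plusD a x y : filt_plus a x -> filt_plus a y -> filt_plus a (x + y).
Proof.
by move=> /andP[xR ax] /andP[yR ay]; rewrite /filt_plus /= rpredD // val_gtD.
Qed.

Lemma filt_plusM a b x y :
  filt a x -> filt_plus b y -> filt_plus (a + b) (x * y).
Proof.
by move=> /andP[xR ax] /andP[yR ay]; rewrite /filt_plus /= rpredM // val_gtM.
Qed.

Lemma rees_plusP (f : rees) :
  reflect (forall a, filt_plus a (val f)@_a) (f \in rees_plus).
Proof.
apply: (iffP allP) => [h a|h a _]; last exact: h.
by have [/h|_] := msuppP (val f) a; rewrite ?filt_plus0.
Qed.

Lemma rees_plus_idealr_closed : idealr_closed rees_plus.
Proof.
split.
- by apply/rees_plusP => a; rewrite rmorph0 mcoeff0 filt_plus0.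
- apply/negP => /rees_plusP/(_ 0); rewrite rmorph1 mcoeff_ga1 eqxx.
  by rewrite /filt_plus /val_gt /= oner_eq0 val1 ltxx andbF.
- move=> f g h /rees_plusP hg /rees_plusP hh; apply/rees_plusP => c.
  rewrite rmorphD rmorphM mcoeffD mcoeff_gaM; apply: filt_plusD => //.
  apply: (big_ind (filt_plus c)) => [||a _];
    [exact: filt_plus0|exact: filt_plusD|].
  apply: (big_ind (filt_plus c)) => [||b _];
    [exact: filt_plus0|exact: filt_plusD|].
  have [<-|_] := eqVneq (a + b) c; last exact: filt_plus0.
  by apply: filt_plusM => //; apply: (rees_predP _ (valP f)).
Qed.

HB.instance Definition _ :=
  isIdealr.Build rees rees_plus rees_plus_idealr_closed.

(** The quotient of [\bigoplus_a P_a(R) t^a] by [\bigoplus_a P_a^+(R) t^a] is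
    [\bigoplus_a P_a(R) / P_a^+(R)], with the product induced by that of [R]. *)
Definition gr : Type := {ideal_quot rees_plus : idealr rees}.
HB.instance Definition _ := GRing.ComNzRing.on gr.

Definition gr_pi (f : rees) : gr := \pi_({ideal_quot rees_plus : idealr rees})%qT f.
HB.instance Definition _ := GRing.RMorphism.copy gr_pi
  (\pi_({ideal_quot rees_plus : idealr rees})%qT : rees -> gr).

Definition gr_repr (x : gr) : rees := repr x.

Lemma gr_reprK : cancel gr_repr gr_pi.
Proof. exact: reprK. Qed.

Lemma gr_piP (f g : rees) : reflect (gr_pi f = gr_pi g) (f - g \in rees_plus).
Proof.
by rewrite (Quotient.idealrBE (rees_plus : idealr rees)); apply: eqP.
Qed.

End Gr.

Arguments filt {K Phi} nu R a.
Arguments filt_plus {K Phi} nu R a.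
Arguments rees_pred {K Phi} nu R f.
Arguments rees_plus {K Phi} nu R f.
Arguments gr_pi {K Phi nu R} f.
Arguments gr_repr {K Phi nu R} x.

Section GrMap.
Variables (K : fieldType) (Phi : orderedZmodType) (nu : valuation K Phi).
Variables (R R' : subringClosed K) (subRR' : {subset R <= R'}).

Lemma rees_sub (f : rees nu R) : val f \in rees_pred nu R'.
Proof.
apply/rees_predP => a; have /andP[fR fa] := rees_predP _ _ _ (valP f) a.
by rewrite /filt /= subRR'.
Qed.

Definition rees_map (f : rees nu R) : rees nu R' := Rees (rees_sub f).

(** The natural map, which sends the class of [x] in [P_a(R) / P_a^+(R)] to its
    class in [P_a(R') / P_a^+(R')]; see [gr_map_pi]. *)
Definition gr_map (x : gr nu R) : gr nu R' := gr_pi (rees_map (gr_repr x)).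

Lemma rees_plus_map (f : rees nu R) :
  f \in rees_plus nu R -> rees_map f \in rees_plus nu R'.
Proof.
move=> /rees_plusP hf; apply/rees_plusP => a.
by have /andP[fR fa] := hf a; rewrite /filt_plus /= subRR'.
Qed.

Lemma gr_map_pi (f : rees nu R) : gr_map (gr_pi f) = gr_pi (rees_map f).
Proof.
apply/gr_piP; set g := gr_repr _.
have /rees_plus_map : g - f \in rees_plus nu R.
  by apply/gr_piP; rewrite gr_reprK.
suff -> : rees_map (g - f) = rees_map g - rees_map f by [].
by apply: val_inj; rewrite !rmorphB.
Qed.

Lemma gr_map_zmod_morphism : zmod_morphism gr_map.
Proof.
move=> x y; rewrite -[x]gr_reprK -[y]gr_reprK -rmorphB !gr_map_pi -rmorphB.
by congr gr_pi; apply: val_inj; rewrite !rmorphB.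
Qed.

Lemma gr_map_monoid_morphism : monoid_morphism gr_map.
Proof.
split=> [|x y].
  have e1 S : gr_pi (1 : rees nu S) = 1 by exact: rmorph1.
  by rewrite -!e1 gr_map_pi; congr gr_pi; apply: val_inj; rewrite /= ?rmorph1.
rewrite -[x]gr_reprK -[y]gr_reprK -rmorphM !gr_map_pi -rmorphM.
by congr gr_pi; apply: val_inj; rewrite !rmorphM.
Qed.

HB.instance Definition _ :=
  GRing.isZmodMorphism.Build (gr nu R) (gr nu R') gr_map gr_map_zmod_morphism.
HB.instance Definition _ :=
  GRing.isMonoidMorphism.Build (gr nu R) (gr nu R') gr_map
    gr_map_monoid_morphism.

End GrMap.

Arguments gr_map {K Phi} nu {R R'} subRR' x.

(* Main.v *)
From HB Require Import structures.
Require Import Defs.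
From mathcomp Require Import all_boot all_order all_algebra.
From mathcomp Require Import boolp classical_sets.
From mathcomp Require Import finmap monalg zify ring lra.

Set Implicit Arguments.
Unset Strict Implicit.
Unset Printing Implicit Defensive.

Import Order.TTheory GRing.Theory Num.Theory.
Local Open Scope ring_scope.

(** Write G(A) for the set of values of the nonzero elements of a ring A, and
    let m = (u, v) be the maximal ideal of R, with a := nu u at most nu v. As
    Phi has rational rank one, it embeds as an ordered group into the rational
    numbers, with a mapped to 1 ([rank1_embedding]).

    Suppose that gr(R') is finitely generated over gr(R). The degrees show that
    G(R') is generated, as a semigroup, by G(R) and finitely many more values
    ([fg_value_sg]). Each of these has a positive multiple in the multiples of
    a, and each enters G(R) after adding some multiple of a, because K is the
    fraction field of R. Hence G(R') + N a is contained in G(R) for some N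
    ([sg_gen_shift]).

    Now let x be a nonzero element of m^(N+1). Then x = u^(N+1) x1 with x1 in
    R[v/u], which is contained in R', and so nu x - a = nu x1 + N a lies in
    G(R). Iterating, every class of G(R) modulo a is the class of the value of
    some element outside m^(N+1) ([descent]).

    On the other hand, if x lies in m^n but not in m^(n+1) and nu x >= k a,
    then R / (x, m^k) has length at most n k, so that G(R) has at most n k
    elements below k a ([few_values]). If the values of the elements outside
    m^(N+1) are bounded, the classes of G(R) modulo a are therefore finite in
    number, being represented by values below a fixed bound. If they are
    unbounded, G(R) has at most N k elements below k a for every k; since each
    class, being stable under adding a, contributes about k of them, there are
    at most N classes ([residues_le]). In both cases the values of R have
    bounded denominators, and Phi is infinite cyclic
    ([bounded_denominators_discrete]), contrary to the hypothesis. *)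

(** * Ordered groups of rational rank one *)

Section Functional.
Variables (Phi : zmodType) (z : Phi).
Hypothesis z_free : forall m : int, z *~ m = 0 -> m = 0.

(** Injectivity of the group of rational numbers, for a subgroup generated by
    one element z: a maximal subgroup H that meets the multiples of z trivially
    makes every element of Phi / H commensurable with z, and the functional is
    the ratio to z. It is needed because a rationalization is only known by its
    universal property, which says nothing on its kernel until a map that does
    not kill z is exhibited. *)
Lemma rational_functional : exists f : {additive Phi -> rat}, f z = 1.
Proof.
pose P (H : set Phi) := (forall x y, H x -> H y -> H (x - y)) /\
  forall m : int, H (z *~ m) -> m = 0.
have [H [[HB Hz] Hmax]] :
    exists H, P H /\ forall H', (H `<` H')%classic -> ~ P H'.
  apply: Zorn_bigcup => F FP Ftot; split=> [x y [A FA Ax] [B FB By]|m [A FA]].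
    case: (Ftot A B FA FB) => [AB|BA].
      by exists B => //; apply: (FP B FB).1 => //; apply: AB.
    by exists A => //; apply: (FP A FA).1 => //; apply: BA.
  exact: (FP A FA).2.
(* H is nonempty: otherwise the zero subgroup would be larger. *)
have H0 : H 0.
  apply: contrapT => nH0; apply: (Hmax [set 0]%classic).
    split=> [|sub]; last by apply/nH0/sub.
    by move=> x Hx; case: nH0; rewrite -(subrr x); apply: HB.
  by split=> [x y -> ->|m /z_free]; rewrite ?subr0.
have HN x : H x -> H (- x) by rewrite -sub0r; apply: HB.
have HD x y : H x -> H y -> H (x + y).
  by move=> Hx /HN Hy; rewrite -[y]opprK; apply: HB.
have HMz x m : H x -> H (x *~ m).
  have Hn n : H x -> H (x *+ n).
    by move=> Hx; elim: n => [|n IH] //; rewrite mulrSr; apply: HD.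
  by case: m => n Hx; [apply: Hn | apply/HN/Hn].
have ratio x : exists nm : int * int, nm.1 != 0 /\ H (x *~ nm.1 - z *~ nm.2).
  have [Hx|nHx] := pselect (H x).
    by exists (1, 0); rewrite mulr0z subr0 mulr1z.
  (* Otherwise H + Z x is larger than H, so it contains a nonzero multiple of
     z. *)
  pose H' : set Phi := [set y | exists h k, H h /\ y = h + x *~ k]%classic.
  have [m [k [Hh m0]]] : exists m k, H (z *~ m - x *~ k) /\ m != 0.
    apply: contrapT => none; apply: (Hmax H'); first split.
    - by move=> h Hh; exists h, 0; rewrite mulr0z addr0.
    - move=> sub; apply/nHx/sub; exists 0, 1; by rewrite add0r mulr1z.
    split=> [_ _ [h [k [Hh ->]]] [h' [k' [Hh' ->]]]|m [h [k [Hh e]]]].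
      exists (h - h'), (k - k'); split; first exact: HB.
      by rewrite mulrzBr opprD addrACA.
    apply/eqP/negPn/negP => m0; apply: none; exists m, k; split=> //.
    by rewrite e addrK.
  exists (k, m) => /=; split; last by rewrite -opprB; apply: HN.
  apply: contra_neq m0 => k0; apply: Hz.
  by move: Hh; rewrite k0 mulr0z subr0.
have [c hc] := choice ratio.
pose f x : rat := (c x).2%:~R / (c x).1%:~R.
have fE x n m : n != 0 -> H (x *~ n - z *~ m) -> f x = m%:~R / n%:~R.
  have [c0 hx] := hc x; move=> n0 hnm.
  have : H ((x *~ (c x).1 - z *~ (c x).2) *~ n - (x *~ n - z *~ m) *~ (c x).1).
    by apply: HB; apply: HMz.
  rewrite !mulrzBl -!mulrzA [n * (c x).1]mulrC opprB addrC addrA subrK.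
  rewrite -mulrzBr => /Hz/eqP; rewrite subr_eq0 => /eqP e.
  apply/eqP; rewrite eqr_div ?intr_eq0 // -!intrM eqr_int.
  by rewrite -e eqxx.
have fB : zmod_morphism f.
  move=> x y; have [cx hx] := hc x; have [cy hy] := hc y.
  rewrite (fE (x - y) ((c x).1 * (c y).1)
    ((c x).2 * (c y).1 - (c y).2 * (c x).1)) ?mulf_neq0 //.
    rewrite rmorphB !rmorphM /= /f; field.
    by rewrite !intr_eq0 ?cx ?cy.
  have -> : (x - y) *~ ((c x).1 * (c y).1) -
      z *~ ((c x).2 * (c y).1 - (c y).2 * (c x).1) =
    (x *~ (c x).1 - z *~ (c x).2) *~ (c y).1 -
    (y *~ (c y).1 - z *~ (c y).2) *~ (c x).1.
    rewrite !mulrzBl mulrzBr !mulrzA [y *~ _ *~ _]mulrzAC.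
    by rewrite !opprB addrACA [RHS]addrACA; congr (_ + _); rewrite addrC.
  by apply: HB; apply: HMz.
pose F : {additive Phi -> rat} := HB.pack f
  (GRing.isZmodMorphism.Build _ _ f fB).
exists F; rewrite /= (fE z 1 1) ?divr1 //.
by rewrite subrr.
Qed.

End Functional.

Section RankOne.
Variable Phi : orderedZmodType.
Implicit Types (x y a : Phi).

Lemma oz_mulrn_gt0 x n : 0 < x -> 0 < x *+ n.+1.
Proof.
move=> x0; elim: n => // n IH; rewrite mulrS; apply: lt_trans x0 _.
by rewrite -[ltLHS]addr0; apply: oz_ltD2l.
Qed.

Lemma oz_lt0N x : x < 0 -> 0 < - x.
Proof. by move=> /(oz_ltD2l (- x)); rewrite addNr addr0. Qed.

Lemma oz_mulrn_ge0 x n : 0 <= x -> 0 <= x *+ n.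
Proof.
case: n => // n; rewrite le_eqVlt => /predU1P[<-|x0]; first by rewrite mul0rn.
exact/ltW/oz_mulrn_gt0.
Qed.

Lemma oz_neq0 x : x != 0 -> (0 < x) || (0 < - x).
Proof.
move=> x0; case/orP: (oz_le_total 0 x) => h.
  by rewrite lt_neqAle eq_sym x0 h.
by rewrite [X in _ || X]oz_lt0N ?orbT // lt_neqAle x0 h.
Qed.

Lemma oz_mulrz_eq0 x (m : int) : x != 0 -> x *~ m = 0 -> m = 0.
Proof.
have pos y : 0 < y -> y *~ m = 0 -> m = 0.
  move=> y0; case: m => [[|k]|k] //.
    by move=> e; have := oz_mulrn_gt0 k y0; rewrite (e : y *+ k.+1 = 0) ltxx.
  move=> /eqP; rewrite NegzE mulrNz oppr_eq0 => /eqP e.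
  by have := oz_mulrn_gt0 k y0; rewrite (e : y *+ k.+1 = 0) ltxx.
move=> /oz_neq0/orP[/pos|/pos h e]; first exact.
by apply: h; rewrite mulNrz e oppr0.
Qed.

Lemma rank1_neq0 : rational_rank Phi 1 -> exists x : Phi, x != 0.
Proof.
move=> [V [i [univ dimV]]]; apply: contrapT => triv.
have i0 x : i x = 0.
  rewrite (_ : x = 0) ?raddf0 //; apply/eqP/negPn/negP => x0.
  by apply: triv; exists x.
have [_ uniq] := univ V i.
have V0 (v : V) : v = 0.
  apply: (uniq (idfun : {linear V -> V}) (\0 : {linear V -> V})) => x.
  by rewrite /= i0.
suff : \dim {:V} = 0%N by rewrite dimV.
by apply/eqP; rewrite dimv_eq0 -subv0; apply/subvP => v _; rewrite [v]V0 mem0v.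
Qed.

(** Since the rationalization V is a line, any functional f with f a = 1 is, on
    Phi, the coordinate with respect to the image of a, hence injective by
    [rational_functional]. If x > 0 had f x <= 0, then a relation
    d x + k a = 0 with d > 0 and k >= 0 would hold in Phi. *)
Lemma rank1_embedding a : 0 < a -> rational_rank Phi 1 ->
  exists f : {additive Phi -> rat}, f a = 1 /\ forall x, (0 < f x) = (0 < x).
Proof.
move=> a0 [V [i [univ dimV]]].
have free x : x != 0 -> forall m : int, x *~ m = 0 -> m = 0.
  by move=> x0 m; apply: oz_mulrz_eq0.
have i_neq0 x : x != 0 -> i x != 0.
  move=> x0; have [h hx] := rational_functional (free x x0).
  have [[g gE] _] := univ rat^o h.
  apply/eqP => ix0; have := gE x; rewrite hx ix0 linear0 => /eqP.
  by rewrite eq_sym oner_eq0.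
have an0 : a != 0 by rewrite gt_eqF.
have [f fa] := rational_functional (free a an0); exists f; split=> //.
have [[g gE] _] := univ rat^o f.
have f_neq0 x : x != 0 -> f x != 0.
  move=> /i_neq0 ix0.
  have /vlineP[c ec] : i x \in <[i a]>%VS.
    have -> : <[i a]>%VS = fullv.
      by apply/eqP; rewrite eqEdim subvf dimV dim_vline i_neq0.
    exact: memvf.
  rewrite -gE ec linearZ /= gE fa [_ *: _]mulr1.
  by apply: contraNneq ix0 => c0; rewrite ec c0 scale0r.
have f_gt0 x : 0 < x -> 0 < f x.
  move=> x0; rewrite ltNge; apply/negP => fx0.
  have [d ed] := denqP (f x).
  have nle : numq (f x) <= 0 by rewrite numq_le0.
  have [k ek] : exists k : nat, numq (f x) = - k%:Z.
    by exists `|numq (f x)|%N; rewrite lez0_abs ?opprK.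
  have e : x *+ d.+1 + a *+ k = 0.
    apply/eqP/negPn/negP => /f_neq0/eqP; apply.
    rewrite raddfD !raddfMn /= fa -mulr_natr.
    have -> : f x * d.+1%:R = (numq (f x))%:~R by rewrite numqE ed.
    by rewrite ek mulrNz addNr.
  have := oz_mulrn_gt0 d x0; rewrite le_gtF //.
  by rewrite -e -[leLHS]addr0 oz_lerD2l // oz_mulrn_ge0 // ltW.
move=> x; apply/idP/idP => [fx|]; last exact: f_gt0.
have x0 : x != 0 by apply: contraTneq fx => ->; rewrite raddf0 ltxx.
case/orP: (oz_neq0 x0) => // /f_gt0.
by rewrite raddfN oppr_gt0 => /lt_trans/(_ fx); rewrite ltxx.
Qed.

Lemma oz_pos_inj (f : {additive Phi -> rat}) :
  (forall x, (0 < f x) = (0 < x)) -> forall x, f x = 0 -> x = 0.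
Proof.
move=> f_gt0 x fx; apply/eqP/negPn/negP => /oz_neq0/orP[];
  by rewrite -f_gt0 ?raddfN fx ?oppr0 ltxx.
Qed.

(** A positive element with f x least possible exists, since f x has denominator
    dividing M, and it generates Phi by Euclidean division. *)
Lemma bounded_denominators_discrete a (f : {additive Phi -> rat}) (M : nat) :
  (0 < M)%N -> f a = 1 -> (forall x, (0 < f x) = (0 < x)) ->
  (forall x, f x * M%:R \is a Num.int) -> discrete_value_group Phi.
Proof.
move=> M0 fa f_gt0 fM.
have f_inj := oz_pos_inj f_gt0.
have ex : exists q : nat, (0 < q)%N && `[< exists x, f x * M%:R = q%:R >].
  by exists M; rewrite M0; apply/asboolP; exists a; rewrite fa mul1r.
have [q /andP[q0 /asboolP[e fe]] qmin] := ex_minnP ex.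
have f_mulz x (k : int) : f (x *~ k) = f x * k%:~R.
  by rewrite raddfMz -mulrzr.
have span x : exists k : int, x = e *~ k.
  have /intrP[n en] := fM x; exists (n %/ q)%Z.
  apply/eqP; rewrite -subr_eq0; apply/eqP/f_inj.
  have rq : (n %% q)%Z < q by rewrite ltz_pmod.
  have r0 : 0 <= (n %% q)%Z by rewrite modz_ge0 // gt_eqF.
  have fr : f (x - e *~ (n %/ q)%Z) * M%:R = (n %% q)%Z%:~R.
    rewrite raddfB f_mulz mulrBl mulrAC fe en /modz rmorphB rmorphM /=.
    by rewrite mulrC.
  have M_neq0 : M%:R != 0 :> rat by rewrite pnatr_eq0 -lt0n.
  apply: (mulIf M_neq0); rewrite mul0r fr.
  case er : (n %% q)%Z rq r0 fr => [[|r]|r] // rq _ fr.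
  have /qmin : (0 < r.+1)%N && `[< exists x, f x * M%:R = r.+1%:R >].
    by apply/asboolP; exists (x - e *~ (n %/ q)%Z).
  by rewrite leqNgt -ltz_nat rq.
have [h hE] := choice span.
have e0 : e != 0.
  apply: contraTneq q0 => e0; rewrite -leqNgt leqn0 -(@pnatr_eq0 rat).
  by rewrite -fe e0 raddf0 mul0r.
have hK : cancel (fun k : int => e *~ k) h.
  move=> k; apply/eqP; rewrite -subr_eq0; apply/eqP.
  by apply: (oz_mulrz_eq0 e0); rewrite mulrzBr -hE subrr.
have hB : zmod_morphism h.
  by move=> x y; rewrite -[RHS]hK mulrzBr -!hE.
pose H : {additive Phi -> int} := HB.pack h
  (GRing.isZmodMorphism.Build _ _ h hB).
by exists H, (fun k : int => e *~ k) => // x; rewrite -hE.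
Qed.

End RankOne.

(** * Semigroups of values and quadratic transforms *)

Section Semigroups.
Variable Phi : orderedZmodType.
Implicit Types (G : Phi -> Prop) (D : seq Phi) (a d t : Phi).

(** The semigroup generated by G and the elements of D, when G is a semigroup
    with 0. *)
Fixpoint sg_gen G D t : Prop :=
  if D is d :: D' then exists s n, sg_gen G D' s /\ t = s + d *+ n else G t.

Lemma sg_gen_base G D t : G t -> sg_gen G D t.
Proof. by elim: D => // d D IH /IH h; exists t, 0%N; rewrite mulr0n addr0. Qed.

Lemma sg_genD G D s t : (forall s t, G s -> G t -> G (s + t)) ->
  sg_gen G D s -> sg_gen G D t -> sg_gen G D (s + t).
Proof.
move=> GD; elim: D s t => [|d D IH] s t; first exact: GD.
move=> [s' [n [hs ->]]] [t' [m [ht ->]]]; exists (s' + t'), (n + m)%N.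
by split; [exact: IH|rewrite mulrnDr addrACA].
Qed.

Lemma sg_gen_mem G D d : G 0 -> d \in D -> sg_gen G D d.
Proof.
move=> G0; elim: D => // e D IH; rewrite inE => /predU1P[->|/IH h].
  by exists 0, 1%N; split; [exact: sg_gen_base|rewrite add0r mulr1n].
by exists d, 0%N; rewrite mulr0n addr0.
Qed.

(** If p d = q a with p > 0, a multiple n d equals a multiple of a plus r d with
    r < p. So only finitely many multiples of each generator have to be moved
    into G, and one multiple of a does it for all of them. *)
Lemma sg_gen_shift G D a :
  G 0 -> (forall s t, G s -> G t -> G (s + t)) -> G a ->
  (forall d, exists m, G (d + a *+ m)) ->
  (forall d, d \in D -> exists p q, (0 < p)%N /\ d *+ p = a *+ q) ->
  exists N, forall t, sg_gen G D t -> G (t + a *+ N).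
Proof.
move=> G0 GD Ga shift.
have GX t n : G t -> G (t *+ n).
  by move=> Gt; elim: n => [|n IH]; rewrite ?mulr0n ?mulrS //; apply: GD.
elim: D => [|d D IH] comm.
  by exists 0%N => t; rewrite mulr0n addr0.
have [e eD|N hN] := IH; first by apply: comm; rewrite inE eD orbT.
have [p [q [p0 pq]]] := comm d (mem_head _ _); have [m Gm] := shift d.
exists (N + m * p)%N => _ [s [n [/hN Gs ->]]].
set k := (n %/ p)%N; set r := (n %% p)%N.
have lt_rp : (r < p)%N by rewrite ltn_pmod.
have -> : s + d *+ n + a *+ (N + m * p) =
    s + a *+ N + a *+ (q * k) + ((d + a *+ m) *+ r + a *+ (m * (p - r))).
  have -> : d *+ n = a *+ (q * k) + d *+ r.
    by rewrite [in LHS](divn_eq n p) mulrnDr mulnC mulrnA pq -mulrnA.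
  have -> : (d + a *+ m) *+ r + a *+ (m * (p - r)) = d *+ r + a *+ (m * p).
    rewrite mulrnDl -mulrnA -addrA -mulrnDr -mulnDr subnKC //.
    exact: ltnW.
  by rewrite mulrnDr addrACA -!addrA.
by apply: (GD); [apply: (GD) Gs _; apply: GX|apply: (GD); apply: GX].
Qed.

End Semigroups.

Section Values.
Variables (K : fieldType) (Phi : orderedZmodType) (nu : valuation K Phi).
Implicit Types (x y : K) (R S T : subringClosed K).

Definition value_sg R (t : Phi) : Prop :=
  exists x, [/\ x \in R, x != 0 & nu x = t].

Lemma value_sg0 R : value_sg R 0.
Proof. by exists 1; rewrite rpred1 oner_neq0 Defs.val1. Qed.

Lemma value_sgD R s t : value_sg R s -> value_sg R t -> value_sg R (s + t).
Proof.
move=> [x [xR x0 <-]] [y [yR y0 <-]]; exists (x * y).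
by rewrite rpredM // mulf_neq0 // vfunM.
Qed.

Lemma vfunV x : x != 0 -> nu x^-1 = - nu x.
Proof.
move=> x0; apply/eqP; rewrite -addr_eq0 -vfunM ?invr_eq0 // mulVf //.
by rewrite Defs.val1.
Qed.

Lemma val_geP a x : x != 0 -> val_ge nu a x = (a <= nu x).
Proof. by move=> x0; rewrite /val_ge /= (negPf x0). Qed.

Lemma val_gtP a x : x != 0 -> val_gt nu a x = (a < nu x).
Proof. by move=> x0; rewrite /val_gt /= (negPf x0). Qed.

Lemma val_exact a x : val_ge nu a x -> ~~ val_gt nu a x -> x != 0 /\ nu x = a.
Proof.
have [->|x0] := eqVneq x 0; first by rewrite val_gt0.
rewrite val_geP // val_gtP // le_eqVlt => /orP[/eqP<- //|->] //.
Qed.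

(** The two cases in the definition of a quadratic transform, merged by naming
    s the parameter of smaller value. When x or y is zero, the comparison of
    values is meaningless; both quotients are then 0, and s is chosen to be the
    nonzero parameter if there is one. *)
Lemma quadratic_generator x y :
  exists s t, [/\ (s, t) = (x, y) \/ (s, t) = (y, x),
    s = 0 -> t = 0, s != 0 -> val_ge nu (nu s) t &
    (if nu x <= nu y then y / x else x / y) = t / s].
Proof.
have [x0|x0] := eqVneq x 0.
  exists y, x; split; [by right|by []| |].
    by rewrite x0 val_ge0.
  by rewrite x0 invr0 mulr0 mul0r if_same.
have [y0|y0] := eqVneq y 0.
  exists x, y; split; [by left|by []| |].
    by rewrite y0 val_ge0.
  by rewrite y0 invr0 mulr0 mul0r if_same.
have [le|nle] := boolP (nu x <= nu y).
  exists x, y; split=> //; [by left|by move/eqP: x0|].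
  by rewrite val_geP.
exists y, x; split=> //; [by right|by move/eqP: y0|].
by rewrite val_geP //; case/orP: (oz_le_total (nu x) (nu y)) nle => ->.
Qed.

Lemma adjoin_val_ring R x : (forall y, y \in R -> val_ge nu 0 y) ->
  val_ge nu 0 x -> forall z, adjoin R x z -> val_ge nu 0 z.
Proof.
move=> RV xV _ [p /polyOverP pR ->]; rewrite horner_coef.
apply: (big_ind (val_ge nu 0)); [exact: val_ge0|exact: val_geD|move=> i _].
rewrite -[0]addr0; apply: val_geM; first exact/RV/pR.
elim: (val i) => [|n IH].
  by rewrite expr0 val_geP ?oner_neq0 // Defs.val1.
by rewrite exprS -[0]addr0; apply: val_geM.
Qed.

Lemma quadratic_transform_val_ring R S : quadratic_transform nu R S ->
  (forall y, y \in R -> val_ge nu 0 y) -> forall z, z \in S -> val_ge nu 0 z.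
Proof.
move=> [u [v [_ H]]] RV z /H[a [b [aA bA bm ->]]].
set x := if _ then _ else _ in aA bA.
have xV : val_ge nu 0 x.
  have [s [t [_ st sv e]]] := quadratic_generator (val u) (val v).
  rewrite [x]e; have [/st->|s0] := eqVneq s 0; first by rewrite mul0r val_ge0.
  rewrite -(subrr (nu s)); apply: val_geM (sv s0) _.
  by rewrite val_geP ?invr_eq0 // vfunV.
have [b0 nb] := val_exact (adjoin_val_ring RV xV bA) (introN idP bm).
rewrite -[0]addr0; apply: val_geM; first exact: (adjoin_val_ring RV xV aA).
by rewrite val_geP ?invr_eq0 // vfunV // nb oppr0.
Qed.

Lemma quadratic_transforms_val_ring R S : quadratic_transforms nu R S ->
  (forall y, y \in R -> val_ge nu 0 y) -> forall z, z \in S -> val_ge nu 0 z.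
Proof.
elim=> {R S} [R S|R T S h _ IH RV]; first exact: quadratic_transform_val_ring.
exact/IH/(quadratic_transform_val_ring h).
Qed.

Lemma quadratic_transforms_first R S : quadratic_transforms nu R S ->
  exists2 T, quadratic_transform nu R T & {subset T <= S}.
Proof.
case=> [h|T h /quadratic_transforms_sub sTS]; first by exists S.
by exists T.
Qed.

(** Maximality of the maximal ideal M of R, applied to M + R c. *)
Lemma maximal_coprime R c : dominates nu R -> c \in R -> ~~ val_gt nu 0 c ->
  exists2 r, r \in R & val_gt nu 0 (1 - r * c).
Proof.
move=> [_ [[idM nM1 maxM] _]] cR cm.
set M := (X in ideal X) in idM nM1 maxM.
pose c' : subring_type R := SubringType cR.
pose I : set (subring_type R) :=
  [set y | exists m r, M m /\ y = m + r * c']%classic.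
have [M0 MD MM] := idM.
have idI : ideal I.
  split; first by exists 0, 0; rewrite mul0r addr0.
  - move=> _ _ [m [r [Mm ->]]] [n [s [Mn ->]]]; exists (m + n), (r + s).
    by split; [exact: MD|rewrite mulrDl addrACA].
  - move=> b _ [m [r [Mm ->]]]; exists (b * m), (b * r).
    by split; [exact: MM|rewrite mulrDr mulrA].
have MI : (M `<=` I)%classic by move=> m Mm; exists m, 0; rewrite mul0r addr0.
case: (maxM I idI MI) => [IM|IT].
  have : I c' by exists 0, 1; rewrite add0r mul1r.
  by rewrite IM /M /= /val_max_ideal /= (negPf cm).
have [m [r [Mm e1]]] : I 1 by rewrite IT.
exists (val r); first exact: valP.
have := congr1 val e1; rewrite rmorph1 rmorphD rmorphM => ->; rewrite addrK.
exact: Mm.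
Qed.

(** The existence of t excludes a zero maximal ideal, whose ring R would be a
    field with all values equal to 0; this is why u can be taken nonzero. *)
Lemma transform_parameters R T :
  dominates nu R -> has_fraction_field R -> (exists t : Phi, t != 0) ->
  quadratic_transform nu R T ->
  exists u v, [/\ u \in R /\ v \in R, u != 0 /\ 0 < nu u, val_ge nu (nu u) v,
    forall y, y \in R -> val_gt nu 0 y ->
      exists r s, [/\ r \in R, s \in R & y = r * u + s * v] &
    forall p, p \is a polyOver R -> p.[v / u] \in T].
Proof.
move=> [RV [maxM uniqM]] frac [t0 t0n] [u [v [[maxG _] HT]]].
have GM := uniqM _ maxG.
have gen y : y \in R -> val_gt nu 0 y ->
    exists r s, [/\ r \in R, s \in R & y = r * val u + s * val v].
  move=> yR ym.
  pose I : set (subring_type R) :=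
    [set z | exists r s, z = r * u + s * v]%classic.
  have idI : ideal I.
    split; first by exists 0, 0; rewrite !mul0r addr0.
    - move=> _ _ [r [s ->]] [r' [s' ->]]; exists (r + r'), (s + s').
      by rewrite !mulrDl addrACA.
    - by move=> b _ [r [s ->]]; exists (b * r), (b * s); rewrite mulrDr !mulrA.
  have : ideal_gen [set u; v]%classic (SubringType yR) by rewrite GM.
  move=> /(_ I) [].
    split=> // _ [->|->]; first by exists 1, 0; rewrite mul1r mul0r addr0.
    by exists 0, 1; rewrite mul1r mul0r add0r.
  move=> r [s /(congr1 val)]; rewrite rmorphD !rmorphM => e.
  by exists (val r), (val s); split=> //; apply: valP.
have um : val_gt nu 0 (val u).
  have : ideal_gen [set u; v]%classic u by move=> I [_]; apply; left.
  by rewrite GM.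
have vm : val_gt nu 0 (val v).
  have : ideal_gen [set u; v]%classic v by move=> I [_]; apply; right.
  by rewrite GM.
have [s [t [st s0t sv e]]] := quadratic_generator (val u) (val v).
have [sR [tR sm]] : s \in R /\ t \in R /\ val_gt nu 0 s.
  by case: st => -[-> ->]; split; [exact: valP|split; first exact: valP|
    exact: valP|split; first exact: valP].
have gen' y : y \in R -> val_gt nu 0 y ->
    exists r r', [/\ r \in R, r' \in R & y = r * s + r' * t].
  move=> yR /(gen y yR)[r [r' [rR r'R ->]]].
  by case: st => -[-> ->]; [exists r, r'|exists r', r; rewrite addrC].
have s0 : s != 0.
  apply/eqP => s0; have t_0 := s0t s0.
  have R0 y : y \in R -> y != 0 -> nu y = 0.
    move=> yR y0; apply: (val_exact (RV y yR) _).2.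
    apply/negP => /(gen' y yR)[r [r' [_ _ ye]]].
    by move: y0; rewrite ye s0 t_0 !mulr0 addr0 eqxx.
  have [x x0 xt] := vfun_surj nu t0.
  have [y [z [yR zR z0 xe]]] := frac x.
  have y0 : y != 0 by apply: contra_neq x0 => y0; rewrite xe y0 mul0r.
  case/eqP: t0n; rewrite -xt xe vfunM ?invr_eq0 // vfunV // !R0 //.
  by rewrite subr0.
exists s, t; split=> //.
- by rewrite -val_gtP.
- exact: sv.
move=> p pR; rewrite -e; apply/HT.
set x := if _ then _ else _; exists p.[x], 1; split.
- by exists p.
- by exists 1; rewrite ?rpred1 // hornerC.
- by rewrite /val_max_ideal /= val_gtP ?oner_neq0 // Defs.val1 ltxx.
- by rewrite divr1.
Qed.

End Values.

(** * Classes of rational numbers modulo the integers *)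

Lemma uniq_map_inj (S T : eqType) (f : S -> T) (s : seq S) :
  uniq (map f s) -> {in s &, injective f}.
Proof.
elim: s => //= z s IH /andP[zs us] x y; rewrite !inE.
move=> /predU1P[->|xs] /predU1P[->|ys] // e; last exact: IH.
  by rewrite e map_f in zs.
by rewrite -e map_f in zs.
Qed.

Section Residues.
Implicit Types (t : rat) (g L : seq rat).

Definition frac t : rat := t - (Num.floor t)%:~R.

Lemma fracDn t n : frac (t + n%:R) = frac t.
Proof.
rewrite /frac floorDrz ?natr_int // rmorphD /=.
have -> : Num.floor (n%:R : rat) = n by exact: (intrKfloor (n : int)).
by rewrite opprD addrACA subrr addr0.
Qed.

Lemma seq_bounded g : exists C : nat, forall t, t \in g -> t < C%:R.
Proof.
elim: g => [|t g [C hC]]; first by exists 0%N.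
exists (C + Num.bound `|t|)%N => s; rewrite inE natrD => /predU1P[->|/hC sC].
  have := archi_boundP (normr_ge0 t); have := ler_norm t.
  have : 0 <= C%:R :> rat by exact: ler0n.
  by lra.
have : 0 <= (Num.bound `|t|)%:R :> rat by exact: ler0n.
by lra.
Qed.

(** If g has more than n elements, then, with C an upper bound of g, the numbers
    t + j with t in g and j < k - C are distinct elements of G below k. There
    are at least (n + 1) (k - C) of them, more than n k for k large. *)
Lemma residues_le (G : rat -> Prop) n g :
  (forall t, G t -> G (t + 1)) ->
  (forall k : nat, exists2 L, (size L <= n * k)%N &
     forall t, G t -> t < k%:R -> t \in L) ->
  (forall t, t \in g -> G t) -> uniq (map frac g) -> (size g <= n)%N.
Proof.
move=> G1 count gG ug; rewrite leqNgt; apply/negP => ltng.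
have [C gC] := seq_bounded g.
have [L sL hL] := count (n.+1 * C + 1)%N.
(* The length of the range of j is k - C for k = (n + 1) C + 1. *)
pose A := [seq t + j%:R | t <- g, j <- iota 0 (n * C).+1].
have uA : uniq A.
  apply: allpairs_uniq; [exact: map_uniq ug|exact: iota_uniq|].
  move=> p p' /allpairsP[[s i] [sg _ ->]] /allpairsP[[s' i'] [sg' _ ->]] /= e.
  rewrite /= in sg sg'.
  have es : s = s'.
    by apply: (uniq_map_inj ug) => //; rewrite -(fracDn s i) e fracDn.
  by move: e; rewrite es => /addrI/eqP; rewrite eqr_nat => /eqP ->.
have GD t j : G t -> G (t + j%:R).
  move=> Gt; elim: j => [|j IH]; first by rewrite addr0.
  by rewrite -natr1 addrA; apply: G1.
have AL : {subset A <= L}.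
  move=> _ /allpairsP[[t j] [tg jC ->]]; rewrite /fst /snd in tg jC *.
  apply: hL; first exact/GD/gG.
  have := gC _ tg; move: jC; rewrite mem_iota add0n ltnS => /andP[_ jC].
  have : j%:R <= (n * C)%:R :> rat by rewrite ler_nat.
  by rewrite addn1 mulSn -addnS natrD -natr1; lra.
have := uniq_leq_size uA AL; rewrite size_allpairs size_iota => le1.
have := leq_trans le1 sL; nia.
Qed.

Lemma finite_or_many_residues (G : rat -> Prop) :
  (exists L, forall t, G t -> frac t \in L) \/
  forall m, exists g,
    [/\ size g = m, forall t, t \in g -> G t & uniq (map frac g)].
Proof.
have [fin|inf] := pselect (exists L, forall t, G t -> frac t \in L).
  by left.
right; elim=> [|m [g [<- gG ug]]]; first by exists [::].
have [t [Gt tg]] : exists t, G t /\ frac t \notin map frac g.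
  apply: contrapT => none; apply: inf; exists (map frac g) => t Gt.
  by apply/negPn/negP => tg; apply: none; exists t.
exists (t :: g); split=> //=; last by rewrite tg.
by move=> s; rewrite inE => /predU1P[->|/gG].
Qed.

End Residues.

(** * Counting the values of a local ring with two parameters *)

Section Counting.
Variables (K : fieldType) (w : K -> rat) (R : subringClosed K).
Hypothesis wM : forall x y : K, x != 0 -> y != 0 -> w (x * y) = w x + w y.
Hypothesis wD : forall x y : K, x != 0 -> y != 0 -> x + y != 0 ->
  Order.min (w x) (w y) <= w (x + y).
Hypothesis wR : forall x, x \in R -> x != 0 -> 0 <= w x.

Definition w_ge (g : rat) (x : K) : Prop := x != 0 -> g <= w x.

(** The maximal ideal of R, when w dominates R. *)
Definition in_max (x : K) : Prop := x \in R /\ (x != 0 -> 0 < w x).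

Lemma w1 : w 1 = 0.
Proof. by have := wM (oner_neq0 K) (oner_neq0 K); rewrite mulr1 => ?; lra. Qed.

Lemma wN x : w (- x) = w x.
Proof.
have [->|x0] := eqVneq x 0; first by rewrite oppr0.
have n0 : -1 != 0 :> K by rewrite oppr_eq0 oner_neq0.
have := wM n0 n0; rewrite mulrNN mulr1 w1 -(mulN1r x) wM // => ?; lra.
Qed.

Lemma w_geD g x y : w_ge g x -> w_ge g y -> w_ge g (x + y).
Proof.
have [->|x0] := eqVneq x 0; first by rewrite add0r.
have [->|y0] := eqVneq y 0; first by rewrite addr0.
move=> /(_ x0) gx /(_ y0) gy s0; apply: le_trans (wD x0 y0 s0).
by rewrite le_min gx.
Qed.

Lemma w_geM g h x y : w_ge g x -> w_ge h y -> w_ge (g + h) (x * y).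
Proof.
move=> gx hy; rewrite /w_ge mulf_eq0 negb_or => /andP[x0 y0].
by rewrite wM // lerD ?gx ?hy.
Qed.

Lemma w_ge_ring x : x \in R -> w_ge 0 x.
Proof. exact: wR. Qed.

Lemma w_ltD x y : x != 0 -> y != 0 -> w x < w y ->
  x + y != 0 /\ w (x + y) = w x.
Proof.
move=> x0 y0 lt.
have s0 : x + y != 0.
  by apply: contraTneq lt => /eqP; rewrite addr_eq0 => /eqP->; rewrite wN ltxx.
split=> //; have := wD x0 y0 s0.
have ny0 : - y != 0 by rewrite oppr_eq0.
have := wD s0 ny0; rewrite addrK wN => /(_ x0).
by rewrite !minEle; do 2![case: ifP => ?] => ? ?; lra.
Qed.

Lemma wX x n : x != 0 -> w (x ^+ n) = n%:R * w x.
Proof.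
move=> x0; elim: n => [|n IH]; first by rewrite expr0 w1 mul0r.
by rewrite exprS wM ?expf_neq0 // IH -natr1; ring.
Qed.

(** The submodule of K generated over R by ws and the elements of value at
    least g. *)
Fixpoint span_ge (g : rat) (ws : seq K) (x : K) : Prop :=
  if ws is y :: ws' then exists2 r, r \in R & span_ge g ws' (x - r * y)
  else w_ge g x.

(** The successive submodules spanned by the tails of ws form a filtration whose
    quotients are killed by the maximal ideal, so that the submodule spanned by
    ws has length at most [size ws] over the elements of value at least g. *)
Fixpoint flag (g : rat) (ws : seq K) : Prop :=
  if ws is y :: ws' then
    (forall c, in_max c -> span_ge g ws' (c * y)) /\ flag g ws'
  else True.

Lemma span_geD g ws x y :
  span_ge g ws x -> span_ge g ws y -> span_ge g ws (x + y).
Proof.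
elim: ws x y => [|z ws IH] x y /=; first exact: w_geD.
move=> [r rR hx] [s sR hy]; exists (r + s); first by rewrite rpredD.
by have -> : x + y - (r + s) * z = (x - r * z) + (y - s * z);
  [ring|exact: IH].
Qed.

Lemma span_geM g ws r x : r \in R -> span_ge g ws x -> span_ge g ws (r * x).
Proof.
move=> rR; elim: ws x => [|z ws IH] x /=.
  by move=> hx; rewrite -[g]add0r; apply: w_geM hx; apply: w_ge_ring.
move=> [s sR hx]; exists (r * s); first by rewrite rpredM.
by have -> : r * x - r * s * z = r * (x - s * z); [ring|exact: IH].
Qed.

Lemma span_geB g ws x y :
  span_ge g ws x -> span_ge g ws y -> span_ge g ws (x - y).
Proof.
move=> hx hy; rewrite -mulN1r; apply: span_geD hx _; apply: span_geM hy.
by rewrite rpredN rpred1.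
Qed.

Lemma span_ge_cat g ws ws' x : span_ge g ws' x -> span_ge g (ws ++ ws') x.
Proof.
elim: ws => //= z ws IH hx; exists 0; first exact: rpred0.
by rewrite mul0r subr0; apply: IH.
Qed.

Lemma span_ge_small g ws x : w_ge g x -> span_ge g ws x.
Proof. by move=> hx; rewrite -[ws]cats0; apply: span_ge_cat. Qed.

Lemma span_ge_mem g ws ws' x : x \in ws -> span_ge g (ws ++ ws') x.
Proof.
elim: ws => //= z ws IH; rewrite inE => /predU1P[->|/IH hx].
  exists 1; first exact: rpred1.
  rewrite mul1r subrr; apply: span_ge_small.
  by rewrite /w_ge eqxx.
by exists 0; rewrite ?rpred0 // mul0r subr0.
Qed.

Lemma span_ge_sum g ws (I : Type) (r : seq I) (P : pred I) (F : I -> K) :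
  (forall i, P i -> span_ge g ws (F i)) ->
  span_ge g ws (\sum_(i <- r | P i) F i).
Proof.
move=> h; apply: big_ind => //; last exact: span_geD.
by apply: span_ge_small; rewrite /w_ge eqxx.
Qed.

Lemma flag_cat g ws ws' :
  (forall y c, y \in ws -> in_max c -> span_ge g ws' (c * y)) ->
  flag g ws' -> flag g (ws ++ ws').
Proof.
elim: ws => //= z ws IH h fl; split=> [c cm|].
  by apply/span_ge_cat/h; rewrite ?mem_head.
by apply: IH fl => y c yws; apply: h; rewrite inE yws orbT.
Qed.

(** Each step of the flag adds at most one value: if x and y lie in the larger
    module and not in the smaller one, some combination s x - r y with
    coefficients of value 0 lies in the smaller one, and if w x and w y were
    different, the lesser of the two would be its value. *)
Lemma flag_values g ws : flag g ws ->
  exists2 L : seq rat, (size L <= size ws)%N &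
  forall x, span_ge g ws x -> x != 0 -> w x < g -> w x \in L.
Proof.
elim: ws => [|z ws IH] /=.
  by move=> _; exists [::] => // x hx x0; rewrite ltNge hx.
move=> [hz /IH[L sL hL]] {IH}.
have [[x [[r rR hx] x0 xg xL]]|none] := pselect (exists x,
    [/\ exists2 r, r \in R & span_ge g ws (x - r * z),
        x != 0, w x < g & w x \notin L]); last first.
  exists L; first exact: leqW.
  by move=> x hx x0 xg; apply/negPn/negP => xL; case: none; exists x.
have unit_coef c y : c \in R -> span_ge g ws (y - c * z) -> y != 0 ->
    w y < g -> w y \notin L -> c != 0 /\ w c = 0.
  move=> cR hy y0 yg yL; apply: contrapT => nc.
  have hc : c != 0 -> w c <> 0 by move=> c0 wc; apply: nc.
  have cm : in_max c.
    by split=> // c0; rewrite lt_neqAle wR // andbT eq_sym; apply/eqP/hc.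
  move/negP: yL; apply; apply: hL => //.
  by rewrite -[y](subrK (c * z)); apply: span_geD hy _; apply: hz.
exists (w x :: L) => // y [s sR hy] y0 yg; rewrite inE.
have [//|yL] := boolP (w y \in L); first by rewrite orbT.
rewrite orbF; apply/eqP.
have [r0 wr] := unit_coef _ _ rR hx x0 xg xL.
have [s0 ws0] := unit_coef _ _ sR hy y0 yg yL.
have hd : span_ge g ws (s * x - r * y).
  have -> : s * x - r * y = s * (x - r * z) - r * (y - s * z) by ring.
  by apply: span_geB; apply: span_geM.
have wx : w (s * x) = w x by rewrite wM // ws0 add0r.
have wy : w (- (r * y)) = w y by rewrite wN wM // wr add0r.
have sx0 : s * x != 0 by rewrite mulf_neq0.
have ry0 : - (r * y) != 0 by rewrite oppr_eq0 mulf_neq0.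
have [lt|lt|//] := ltgtP (w y) (w x).
  have [] := @w_ltD _ _ ry0 sx0; rewrite ?wx ?wy // addrC => d0 wd.
  by move: yL; rewrite -wd hL // wd.
have [] := @w_ltD _ _ sx0 ry0; rewrite ?wx ?wy // => d0 wd.
by move: xL; rewrite -wd hL // wd.
Qed.

Variables u v : K.
Hypothesis uR : u \in R.
Hypothesis vR : v \in R.
Hypothesis u0 : u != 0.
Hypothesis wu : w u = 1.
Hypothesis wv : w_ge 1 v.
Hypothesis max_gen : forall x, in_max x ->
  exists r s, [/\ r \in R, s \in R & x = r * u + s * v].
Hypothesis inv_mod : forall c, c \in R -> ~ in_max c ->
  exists2 r, r \in R & in_max (1 - r * c).

Definition form (n : nat) (c : nat -> K) : K :=
  \sum_(j < n.+1) c j * (u ^+ j * v ^+ (n - j)).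

Definition is_form (n : nat) (x : K) : Prop :=
  exists2 c : nat -> K, (forall j, c j \in R) & x = form n c.

(** In a regular local ring with parameters u and v, this says that x lies in
    m^n but not in m^(n+1); the explicit coefficients are what the counting
    uses. *)
Definition exact_form (n : nat) (x : K) : Prop :=
  exists c i, [/\ forall j, c j \in R, (i <= n)%N, ~ in_max (c i) &
    x = form n c].

Lemma monomR p q : u ^+ p * v ^+ q \in R.
Proof. by rewrite rpredM ?rpredX. Qed.

Lemma w_ge_monom p q : w_ge (p + q)%:R (u ^+ p * v ^+ q).
Proof.
rewrite natrD; apply: w_geM => [_|]; first by rewrite wX // wu mulr1.
elim: q => [|q IH]; first by rewrite expr0 => _; rewrite w1.
by rewrite exprS -natr1 addrC; apply: w_geM.
Qed.

(** Monomials of degree s that span m^s modulo m^(s+1) and a form of degree n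
    whose coefficient at u^i v^(n-i) is a unit, while those at lower powers of u
    are not. When s is small, truncated subtraction makes some of them monomials
    of higher degree, which does no harm and keeps the size equal to n. *)
Definition layer n i s : seq K :=
  [seq u ^+ p * v ^+ (s - p) | p <- iota 0 i] ++
  [seq u ^+ (s - q) * v ^+ q | q <- iota 0 (n - i)].

Lemma mem_layerl n i s p q :
  (p < i)%N -> (p + q)%N = s -> u ^+ p * v ^+ q \in layer n i s.
Proof.
move=> pi <-; rewrite mem_cat; apply/orP; left.
by apply/mapP; exists p; rewrite ?mem_iota ?add0n // addKn.
Qed.

Lemma mem_layerr n i s p q :
  (q < n - i)%N -> (p + q)%N = s -> u ^+ p * v ^+ q \in layer n i s.
Proof.
move=> qi <-; rewrite mem_cat; apply/orP; right.
by apply/mapP; exists q; rewrite ?mem_iota ?add0n // addnK.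
Qed.

Lemma layer_monom n i s y : y \in layer n i s ->
  exists p q, (s <= p + q)%N /\ y = u ^+ p * v ^+ q.
Proof.
rewrite mem_cat => /orP[/mapP[p _ ->]|/mapP[q _ ->]].
  by exists p, (s - p)%N; split=> //; lia.
by exists (s - q)%N, q; split=> //; lia.
Qed.

(** The layers of degrees k - d, ..., k - 1. *)
Fixpoint layers n i k d : seq K :=
  if d is d'.+1 then layer n i (k - d) ++ layers n i k d' else [::].

Lemma size_layers n i k d : (i <= n)%N -> size (layers n i k d) = (n * d)%N.
Proof.
move=> le_in; elim: d => [|d IH]; first by rewrite muln0.
by rewrite [layers _ _ _ _]/= !size_cat !size_map !size_iota IH; lia.
Qed.

Lemma max_monom g ws s :
  (forall p q, (s < p + q)%N -> span_ge g ws (u ^+ p * v ^+ q)) ->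
  forall c p q, in_max c -> (s <= p + q)%N ->
  span_ge g ws (c * (u ^+ p * v ^+ q)).
Proof.
move=> h c p q /max_gen[r [t [rR tR ->]]] spq.
have -> : (r * u + t * v) * (u ^+ p * v ^+ q) =
  r * (u ^+ p.+1 * v ^+ q) + t * (u ^+ p * v ^+ q.+1) by rewrite !exprS; ring.
by apply: span_geD; apply: span_geM => //; apply: h; lia.
Qed.

(** Modulo the form, which is negligible as its value is at least k, the
    monomial u^p v^q with p >= i and q >= n - i is a combination of monomials of
    the same degree with a higher power of u, and of monomials of higher degree.
    So it is in the span by induction on the degree downwards, then on q. *)
Lemma layers_flag n i k c :
  (i <= n)%N -> (forall j, c j \in R) -> ~ in_max (c i) ->
  (forall j, (j < i)%N -> in_max (c j)) -> w_ge k%:R (form n c) ->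
  forall d, (d <= k)%N ->
  flag k%:R (layers n i k d) /\
  forall p q, (k <= p + q + d)%N ->
    span_ge k%:R (layers n i k d) (u ^+ p * v ^+ q).
Proof.
move=> le_in cR ci lti wf; elim=> [|d IH] ltdk.
  split=> // p q; rewrite addn0 => kpq u0v.
  by apply: le_trans (w_ge_monom u0v); rewrite ler_nat.
have [fl sp] := IH (ltnW ltdk); set J := layers n i k d.
have above p q : (k - d.+1 < p + q)%N -> span_ge k%:R J (u ^+ p * v ^+ q).
  by move=> h; apply: sp; lia.
split=> /=.
  apply: flag_cat fl => y e /layer_monom[p [q [spq ->]]] em.
  exact: max_monom above _ _ _ em spq.
move=> p q kpq.
have [eq_s|ne_s] := eqVneq (p + q)%N (k - d.+1)%N; last first.
  by apply/span_ge_cat/above; lia.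
elim/ltn_ind: q p kpq eq_s => q IHq p kpq eq_s.
have [pi|ip] := ltnP p i; first by apply/span_ge_mem/mem_layerl.
have [qi|iq] := ltnP q (n - i); first by apply/span_ge_mem/mem_layerr.
set W := layer n i _ ++ _.
have cspan : span_ge k%:R W (c i * (u ^+ p * v ^+ q)).
  have -> : c i * (u ^+ p * v ^+ q) =
      u ^+ (p - i) * v ^+ (q - (n - i)) * form n c -
      \sum_(j < n.+1 | j != i :> nat)
         c j * (u ^+ (p - i + j) * v ^+ (q - (n - i) + (n - j))).
    have lt_in : (i < n.+1)%N by [].
    rewrite /form mulr_sumr (bigD1 (Ordinal lt_in)) //= [X in _ + X - _](eq_bigr
      (fun j : 'I_n.+1 =>
         c j * (u ^+ (p - i + j) * v ^+ (q - (n - i) + (n - j))))).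
      rewrite addrK [RHS]mulrCA; congr (_ * _).
      by rewrite mulrACA -!exprD subnK // subnK.
    by move=> j _; rewrite mulrCA mulrACA -!exprD.
  apply: span_geB.
    apply: span_ge_small; rewrite -[k%:R]add0r.
    by apply: w_geM wf; apply: w_ge_ring; apply: monomR.
  apply: span_ge_sum => j ji.
  have jn : (j <= n)%N by rewrite -ltnS.
  have [ltji|leij] := ltnP j i.
    apply/span_ge_cat/(max_monom above); first exact: lti.
    by lia.
  apply: span_geM => //; apply: IHq; lia.
have [r rR rm] := inv_mod (cR i) ci.
have -> : u ^+ p * v ^+ q =
  r * (c i * (u ^+ p * v ^+ q)) + (1 - r * c i) * (u ^+ p * v ^+ q) by ring.
apply: span_geD; first exact: span_geM.
by apply/span_ge_cat/(max_monom above) => //; lia.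
Qed.

(** The multiples of x and the elements of m^k have value at least k, and
    R / (x, m^k) has length at most n k: the span of all the layers below degree
    k contains the monomial 1, hence R. *)
Lemma few_values n x k : exact_form n x -> w_ge k%:R x ->
  exists2 L : seq rat, (size L <= n * k)%N &
  forall y, y \in R -> y != 0 -> w y < k%:R -> w y \in L.
Proof.
move=> [c [i0 [cR i0n ci0 ->]]] wx.
have ex : exists i, (fun i => (i <= n)%N && `[< ~ in_max (c i) >]) i.
  by exists i0; rewrite i0n; apply/asboolP.
have [i /andP[le_in /asboolP ci] imin] := ex_minnP ex.
have lti j : (j < i)%N -> in_max (c j).
  move=> ji; apply: contrapT => cj.
  have /imin : (j <= n)%N && `[< ~ in_max (c j) >].
    by rewrite (leq_trans (ltnW ji) le_in); apply/asboolP.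
  by rewrite leqNgt ji.
have [fl sp] := layers_flag le_in cR ci lti wx (leqnn k).
have [L sL hL] := flag_values fl.
exists L; first by rewrite -(size_layers k k le_in).
move=> y yR y0 yk; apply: hL => //; rewrite -[y]mulr1; apply: span_geM => //.
by have := sp 0%N 0%N; rewrite !expr0 mulr1; apply; lia.
Qed.

Lemma is_formD n x y : is_form n x -> is_form n y -> is_form n (x + y).
Proof.
move=> [c cR ->] [d dR ->]; exists (fun j => c j + d j).
  by move=> j; rewrite rpredD.
by rewrite -big_split; apply: eq_bigr => j _; rewrite /= mulrDl.
Qed.

Lemma is_form_monom n p r : (p <= n)%N -> r \in R ->
  is_form n (r * (u ^+ p * v ^+ (n - p))).
Proof.
move=> pn rR; exists (fun j => if j == p then r else 0).
  by move=> j; case: ifP => // _; apply: rpred0.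
have pn' : (p < n.+1)%N by [].
rewrite /form (bigD1 (Ordinal pn')) //= eqxx big1 ?addr0 // => j.
by rewrite -val_eqE /= => /negPf ->; rewrite mul0r.
Qed.

(** Expand x in forms of increasing degree as long as all the coefficients are
    in the maximal ideal. *)
Lemma form_or_exact N x : x \in R ->
  is_form N x \/ exists2 n, (n < N)%N & exact_form n x.
Proof.
move=> xR; elim: N => [|N [[c cR xc]|[n nN hn]]]; last 1 first.
- by right; exists n => //; apply: leqW.
- left; exists (fun=> x) => //.
  by rewrite /form big_ord_recl big_ord0 !expr0 !mulr1 addr0.
have [[i [iN ci]]|none] := pselect (exists i, (i <= N)%N /\ ~ in_max (c i)).
  by right; exists N => //; exists c, i.
left; rewrite xc /form; apply: (big_ind (is_form N.+1)); last 1 first.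
- move=> [j /=]; rewrite ltnS => jN _.
  have /max_gen[r [s [rR sR ->]]] : in_max (c j).
    by apply: contrapT => cj; apply: none; exists j.
  have -> : (r * u + s * v) * (u ^+ j * v ^+ (N - j)) =
    r * (u ^+ j.+1 * v ^+ (N.+1 - j.+1)) + s * (u ^+ j * v ^+ (N.+1 - j)).
    by rewrite subSS subSn // !exprS; ring.
  by apply: is_formD; apply: is_form_monom => //; apply: leqW.
- rewrite -[0](mul0r (u ^+ 0 * v ^+ (N.+1 - 0))).
  by apply: is_form_monom => //; apply: rpred0.
exact: is_formD.
Qed.

Definition vals (t : rat) : Prop := exists x, [/\ x \in R, x != 0 & w x = t].

Lemma exact_form_uX n : exact_form n (u ^+ n).
Proof.
exists (fun j => if j == n then 1 else 0), n; split=> //.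
- by move=> j; case: ifP; rewrite ?rpred0 ?rpred1.
- by rewrite eqxx => -[_ /(_ (oner_neq0 K))]; rewrite w1.
rewrite /form big_ord_recr /= eqxx subnn mulr1 mul1r big1 ?add0r // => j _.
by rewrite ltn_eqF ?mul0r.
Qed.

Lemma vals1 t : vals t -> vals (t + 1).
Proof.
move=> [x [xR x0 <-]]; exists (x * u).
by rewrite rpredM // mulf_neq0 // wM // wu.
Qed.

(** An element that is a form of degree N can be replaced by one whose value is
    less by 1. This stops, as values are nonnegative, at an exact form of degree
    less than N. *)
Lemma descent N :
  (forall x, x \in R -> x != 0 -> is_form N x -> vals (w x - 1)) ->
  forall x, x \in R -> x != 0 -> exists y n,
    [/\ y \in R, y != 0, frac (w y) = frac (w x), (n < N)%N & exact_form n y].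
Proof.
move=> down x; have [B] := seq_bounded [:: w x].
move=> /(_ _ (mem_head _ _)); elim: B x => [|B IH] x xB xR x0.
  by have := wR xR x0; rewrite leNgt xB.
have [xf|[n nN xn]] := form_or_exact N xR; last by exists x, n.
have [y [yR y0 wy]] := down x xR x0 xf.
have [|z [n [zR z0 ez nN zn]]] := IH y _ yR y0.
  by move: xB; rewrite wy -natr1; lra.
exists z, n; split=> //; rewrite ez wy -[in RHS](subrK 1 (w x)).
exact/esym/(fracDn _ 1).
Qed.

(** Either the exact forms of degree less than N have bounded values, and the
    values below the bound represent all classes, or [few_values] applies to
    some n < N for every k, and [residues_le] leaves at most N classes. *)
Lemma finite_residues N :
  (forall x, x \in R -> x != 0 -> is_form N x -> vals (w x - 1)) ->
  exists L : seq rat, forall x, x \in R -> x != 0 -> frac (w x) \in L.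
Proof.
move=> down; have red := descent down.
have [[L hL]|many] := finite_or_many_residues vals.
  by exists L => x xR x0; apply: hL; exists x.
have [[k hk]|unb] := pselect (exists k : nat, forall x n, (n < N)%N ->
    exact_form n x -> x != 0 -> w x < k%:R).
  (* u^k is a form of degree k and value k, so that few_values bounds the
     number of values below k. *)
  have [|L _ hL] := few_values (k := k) (exact_form_uX k).
    by move=> _; rewrite wX // wu mulr1.
  exists (map frac L) => x xR x0; have [y [n [yR y0 <- nN yn]]] := red x xR x0.
  by rewrite map_f // hL // (hk y n).
have [g [sg gG ug]] := many N.+1.
suff : (N.+1 <= N)%N by rewrite ltnn.
rewrite -{1}sg; apply: residues_le gG ug; first exact: vals1.
move=> k; have [x [n [nN xn xk]]] : exists x n,
    [/\ (n < N)%N, exact_form n x & w_ge k%:R x].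
  apply: contrapT => none; apply: unb; exists k => x n nN xn x0.
  rewrite ltNge; apply/negP => kx.
  by apply: none; exists x, n; split.
have [L sL hL] := few_values xn xk.
exists L; first by rewrite (leq_trans sL) // leq_mul2r ltnW // orbT.
by move=> t [y [yR y0 <-]]; apply: hL.
Qed.

End Counting.

(** * Finite generation of associated graded rings *)

Section FiniteGeneration.
Variables (K : fieldType) (Phi : orderedZmodType) (nu : valuation K Phi).
Variables (R R' : subringClosed K) (subRR' : {subset R <= R'}).

Lemma big_not_val_gt (a : Phi) (I : Type) (r : seq I) (F : I -> K) :
  ~~ val_gt nu a (\sum_(i <- r) F i) -> exists i, ~~ val_gt nu a (F i).
Proof.
move=> h; apply: contrapT => none; move/negP: h; apply.
apply: (big_ind (val_gt nu a)); [exact: val_gt0|exact: val_gtD|move=> i _].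
by apply/negPn/negP => hi; apply: none; exists i.
Qed.

(** The classes with a representative all of whose nonzero homogeneous
    components have degree in a given semigroup form a subring of gr(R'). For
    the semigroup generated by the values of R and the degrees occurring in the
    generators, this subring is everything. A component of degree c counts as
    nonzero only when its value is exactly c, that is, when it is not of value
    greater than c. *)
Lemma fg_value_sg :
  finitely_generated_algebra (gr_map nu subRR') ->
  (forall x, x \in R' -> val_ge nu 0 x) ->
  exists D : seq Phi, (forall d, d \in D -> 0 <= d) /\
    forall t, value_sg nu R' t -> sg_gen (value_sg nu R) D t.
Proof.
move=> [s hs] R'V.
pose D := [seq d <-
  flatten [seq enum_fset (msupp (rees_val (gr_repr x))) | x <- s] | 0 <= d].
pose T := sg_gen (value_sg nu R) D.
exists D; split=> [d|t [x [xR' x0 xt]]]; first by rewrite mem_filter => /andP[].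
have TD := sg_genD (D := D) (@value_sgD _ _ nu R).
pose P (b : gr nu R') := exists2 F : rees nu R', gr_pi F = b &
  forall c, ~~ val_gt nu c (rees_val F)@_c -> T c.
have filtF (F : rees nu R') c : filt nu R' c (rees_val F)@_c.
  exact: (rees_predP _ _ _ (valP F)).
have Pall b : P b.
  apply: hs b => [a|y ys|_ _ [F <- hF] [G <- hG]|_ _ [F <- hF] [G <- hG]].
  - exists (rees_map subRR' (gr_repr a)) => // c /= hc.
    have /andP[cR cge] := rees_predP _ _ _ (valP (gr_repr a)) c.
    have [y0 yc] := val_exact cge hc.
    by apply: sg_gen_base; exists (rees_val (gr_repr a))@_c.
  - exists (gr_repr y); first exact: gr_reprK.
    move=> c hc; have /andP[cR cge] := filtF (gr_repr y) c.
    have [y0 yc] := val_exact cge hc.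
    apply: sg_gen_mem; first exact: value_sg0.
    rewrite mem_filter -{1}yc -val_geP // R'V //=.
    apply/flattenP; exists (enum_fset (msupp (rees_val (gr_repr y)))).
      by apply/mapP; exists y.
    by rewrite -[_ \in _]/(c \in msupp _) -mcoeff_neq0.
  - exists (F + G); first exact: rmorphD.
    move=> c; rewrite [rees_val _](rmorphD val) mcoeffD => h.
    have [/hF//|cF] := boolP (~~ val_gt nu c (rees_val F)@_c).
    apply: hG; apply: contra h; apply: val_gtD; exact/negPn.
  - exists (F * G); first exact: rmorphM.
    move=> c; rewrite [rees_val _](rmorphM val) mcoeff_gaM.
    move=> /big_not_val_gt[a /big_not_val_gt[b]].
    have [<-|_] := eqVneq (a + b) c; last by rewrite mulr0n val_gt0.
    rewrite mulr1n => h; apply: TD.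
      apply: hF; apply: contra h => h; rewrite mulrC addrC.
      by apply: val_gtM h; have /andP[] := filtF G b.
    by apply: hG; apply: contra h; apply: val_gtM; have /andP[] := filtF F a.
pose f0 : group_algebra K Phi := << x *g t >>.
have f0P : f0 \in rees_pred nu R'.
  apply/rees_predP => c; rewrite mcoeffU.
  have [<-|_] := eqVneq t c; last by rewrite mulr0n filt0.
  by rewrite mulr1n; apply/andP; split=> //; rewrite val_geP // xt lexx.
have [F /gr_piP/rees_plusP/(_ t) Ff hF] := Pall (gr_pi (Rees f0P)).
apply: hF; apply/negP => ht.
move: Ff; rewrite (rmorphB val) mcoeffB /= mcoeffU eqxx mulr1n.
move=> /andP[_ hd].
have : val_gt nu t ((rees_val F)@_t - ((rees_val F)@_t - x)).
  apply: val_gtD ht _; rewrite -mulN1r.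
  have N1 : val_ge nu 0 (-1) by rewrite val_geP ?oppr_eq0 ?oner_neq0 // valN1.
  by have := val_gtM N1 hd; rewrite add0r.
by rewrite opprB addrC subrK val_gtP // xt ltxx.
Qed.

End FiniteGeneration.

Theorem corollary0p6 (K : fieldType) (Phi : orderedZmodType)
    (nu : valuation K Phi) (R R' : subringClosed K)
    (regR : regular_local_ring_dim (subring_type R) 2)
    (excR : excellent (subring_type R))
    (fracR : has_fraction_field R)
    (domR : dominates nu R)
    (rk1 : rational_rank Phi 1)
    (ndisc : ~ discrete_value_group Phi)
    (seqR : quadratic_transforms nu R R') :
  ~ finitely_generated_algebra (gr_map nu (quadratic_transforms_sub seqR)).
Proof.
move=> fg; apply: ndisc.
have RV : forall x, x \in R -> val_ge nu 0 x := domR.1.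
have R'V := quadratic_transforms_val_ring seqR RV.
have [T qt TR'] := quadratic_transforms_first seqR.
have [u [v [[uR vR] [u0 nu_u] nu_v gen adjT]]] :=
  transform_parameters domR fracR (rank1_neq0 rk1) qt.
set a := nu u in nu_u nu_v.
have [f [fa f_gt0]] := rank1_embedding nu_u rk1.
have f_ge0 t : 0 <= t -> 0 <= f t.
  by rewrite le_eqVlt => /predU1P[<-|]; [rewrite raddf0|rewrite -f_gt0 => /ltW].
have f_le s t : s <= t -> f s <= f t.
  move=> st; rewrite -subr_ge0 -raddfB f_ge0 //.
  by rewrite -(addNr s) [t - s]addrC oz_lerD2l.
have f_inj := oz_pos_inj f_gt0.
have comm d : 0 <= d -> exists p q, (0 < p)%N /\ d *+ p = a *+ q.
  move=> /f_ge0 fd; have [p ep] := denqP (f d).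
  exists p.+1, `|numq (f d)|%N; split=> //.
  apply/eqP; rewrite -subr_eq0; apply/eqP/f_inj.
  rewrite raddfB !raddfMn /= fa -[_ *+ p.+1]mulr_natr.
  have -> : f d * p.+1%:R = (numq (f d))%:~R by rewrite numqE ep.
  have {1}-> : numq (f d) = `|numq (f d)|%N :> int.
    by rewrite gez0_abs // numq_ge0.
  by rewrite mulNrn -pmulrn subrr.
pose G := value_sg nu R.
have GX t n : G t -> G (t *+ n).
  move=> Gt; elim: n => [|n IH]; first exact: value_sg0.
  by rewrite mulrS; apply: value_sgD.
have group_values t : exists x y, [/\ x \in R, y \in R, x != 0, y != 0 &
    t = nu x - nu y].
  have [z z0 <-] := vfun_surj nu t; have [x [y [xR yR y0 ze]]] := fracR z.
  have x0 : x != 0 by apply: contra_neq z0 => x0; rewrite ze x0 mul0r.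
  by exists x, y; split=> //; rewrite ze vfunM ?invr_eq0 // vfunV.
have shift d : exists m, G (d + a *+ m).
  have [x [y [xR yR x0 y0 ->]]] := group_values d.
  have [|p [q [p0 pq]]] := comm (nu y); first by rewrite -val_geP ?RV.
  case: p p0 pq => // p _ pq.
  exists q; rewrite -pq mulrS addrA subrK; apply: value_sgD; first by exists x.
  by apply: GX; exists y.
have [D [D0 DR']] := fg_value_sg fg R'V.
have [N hN] : exists N, forall t, sg_gen G D t -> G (t + a *+ N).
  apply: sg_gen_shift => //; [exact: value_sg0|exact: value_sgD|by exists u|].
  by move=> d /D0; apply: comm.
(* From here on values are rational numbers, and nu u is 1. *)
pose w x := f (nu x).
have wM x y : x != 0 -> y != 0 -> w (x * y) = w x + w y.
  by move=> x0 y0; rewrite /w vfunM // raddfD.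
have wD x y : x != 0 -> y != 0 -> x + y != 0 ->
    Order.min (w x) (w y) <= w (x + y).
  move=> x0 y0 s0; have := f_le _ _ (vfunD nu x0 y0 s0).
  apply: le_trans; rewrite ge_min /Order.min.
  by case: ifP => _; rewrite lexx ?orbT.
have wR x : x \in R -> x != 0 -> 0 <= w x.
  by move=> xR x0; rewrite f_ge0 // -val_geP // RV.
have in_maxE x : x \in R -> in_max w R x <-> val_gt nu 0 x.
  move=> xR; have [->|x0] := eqVneq x 0.
    by rewrite val_gt0; split=> // _; split; rewrite ?rpred0 // eqxx.
  rewrite val_gtP // -f_gt0; split=> [[_ /(_ x0)]//|h]; split=> //.
have wv : w_ge w 1 v.
  by move=> v0; rewrite -fa f_le // -val_geP.
have max_gen x : in_max w R x ->
    exists r s, [/\ r \in R, s \in R & x = r * u + s * v].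
  by move=> xm; have xR := xm.1; apply: gen => //; apply/(in_maxE x xR).
have inv_mod c : c \in R -> ~ in_max w R c ->
    exists2 r, r \in R & in_max w R (1 - r * c).
  move=> cR cm; have [|r rR rm] := maximal_coprime domR cR.
    by apply/negP => /(in_maxE c cR).
  by exists r => //; apply/in_maxE => //; rewrite rpredB ?rpred1 ?rpredM.
(* p is the form divided by u^(N+1), as a polynomial in v / u. *)
have down x : x \in R -> x != 0 -> is_form R u v N.+1 x ->
    vals w R (w x - 1).
  move=> xR x0 [c cR xc].
  pose p : {poly K} := \sum_(j < N.+2) (c j)%:P * 'X^(N.+1 - j).
  have pR : p \is a polyOver R.
    apply: rpred_sum => j _; rewrite rpredM ?polyOverC ?cR //.
    by rewrite polyOverXn.
  have xp : x = u ^+ N.+1 * p.[v / u].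
    rewrite xc /form horner_sum mulr_sumr; apply: eq_bigr => j _.
    rewrite hornerM hornerC hornerXn [RHS]mulrCA; congr (_ * _).
    have jN : (j <= N.+1)%N by rewrite -ltnS.
    have -> : u ^+ N.+1 = u ^+ j * u ^+ (N.+1 - j) by rewrite -exprD subnKC.
    rewrite exprMn exprVn -mulrA; congr (_ * _).
    by rewrite mulrCA mulfV ?mulr1 // expf_neq0.
  have p0 : p.[v / u] != 0.
    by apply: contra_neq x0 => p0; rewrite xp p0 mulr0.
  have : G (nu p.[v / u] + a *+ N).
    by apply/hN/DR'; exists p.[v / u]; split=> //; apply/TR'/adjT.
  move=> [y [yR y0 yv]]; exists y; split=> //.
  have wX n : w (u ^+ n) = n%:R.
    elim: n => [|n IH]; first by rewrite expr0 /w Defs.val1 raddf0.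
    by rewrite exprS wM ?expf_neq0 // IH /w fa -natr1 addrC.
  rewrite /w yv raddfD raddfMn /= fa xp -/(w _) -/(w _) wM ?expf_neq0 // wX.
  by rewrite -natr1; ring.
have [L hL] := finite_residues wM wD wR uR vR u0 fa wv max_gen inv_mod down.
pose M := (\prod_(t <- L) `|denq t|)%N.
have M0 : (0 < M)%N by rewrite prodn_gt0 // => t; rewrite absz_gt0 denq_neq0.
have wM_int x : x \in R -> x != 0 -> w x * M%:R \is a Num.int.
  move=> xR x0; have /dvdnP[k Mk] : (`|denq (frac (w x))| %| M)%N.
    have := hL x xR x0; rewrite /M; elim: (L) => //= t0 L' IH.
    rewrite inE big_cons => /predU1P[->|/IH]; first exact: dvdn_mulr.
    exact: dvdn_mull.
  have -> : w x = frac (w x) + (Num.floor (w x))%:~R by rewrite subrK.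
  rewrite mulrDl rpredD //; last by rewrite rpredM ?rpred_nat ?intr_int.
  rewrite Mk natrM mulrCA rpredM ?natr_int //.
  rewrite -[_%:R]/((`|denq (frac (w x))|%N : int)%:~R) absz_denq -numqE.
  exact: intr_int.
apply: (bounded_denominators_discrete M0 fa f_gt0) => t.
have [x [y [xR yR x0 y0 ->]]] := group_values t.
by rewrite raddfB mulrBl rpredB // wM_int.
Qed.
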